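(* Fix $\gamma\in[0,1)$, $R_{\max}>0$ and $K\ge1$, and let $\tau_k=\frac{2k-1}{2K}$. For every MDP with discount factor $\gamma$ whose reward distributions are all supported on $[-R_{\max},R_{\max}]$ and every policy $\pi$, let $\eta$ be the QDRL fixed point, i.e. the collection of distributions of the form $\eta(x,a)=\frac1K\sum_{k=1}^K\delta_{z_k(x,a)}$ satisfying $\eta=\Pi_{W_1}\mathcal T^\pi\eta$, and let $\hat s_k(x,a)=F^{-1}_{\eta(x,a)}(\tau_k)$ be the learnt quantile statistics. Then $$\sup_{(x,a)\in\mathcal X\times\mathcal A}\frac1K\sum_{k=1}^K\big|F^{-1}_{\eta^\pi(x,a)}(\tau_k)-\hat s_k(x,a)\big|\le\frac{2R_{\max}(5-2\gamma)}{(1-\gamma)^2K}.$$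
   Context: MDP setting: finite state space $\mathcal X$, finite action space $\mathcal A$, transition kernel $p$, discount $\gamma$, reward distributions $\mathcal R(\cdot\mid x,a)$; policy $\pi:\mathcal X\to\mathscr P(\mathcal A)$; $\eta^\pi(x,a)$ is the law of the return $\sum_t\gamma^tR_t$ from $X_0=x,A_0=a$ with $R_t\sim\mathcal R(\cdot\mid X_t,A_t)$, $X_{t+1}\sim p(\cdot\mid X_t,A_t)$, $A_{t+1}\sim\pi(\cdot\mid X_{t+1})$. Distributional Bellman operator: $(\mathcal T^\pi\eta)(x,a)=\sum_{x',a'}p(x'\mid x,a)\pi(a'\mid x')\int\mathcal R(\mathrm dr\mid x,a)(f_{r,\gamma})_\#\eta(x',a')$ with $f_{r,\gamma}(z)=r+\gamma z$. For a distribution $\mu$ with CDF $F_\mu$, $F_\mu^{-1}(\tau)=\inf\{z:F_\mu(z)\ge\tau\}$, and $\Pi_{W_1}(\mu)=\frac1K\sum_{k=1}^K\delta_{F_\mu^{-1}(\tau_k)}$, applied statewise to collections. *)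

(* Defs.v *)
From HB Require Import structures.
From mathcomp Require Import all_boot all_order all_algebra.
From mathcomp Require Import all_classical all_reals all_analysis.
Set Implicit Arguments. Unset Strict Implicit. Unset Printing Implicit Defensive.
Import Order.TTheory GRing.Theory Num.Theory.
Local Open Scope classical_set_scope.
Local Open Scope ring_scope.

Definition is_fdist (R : realType) (T : finType) (f : T -> R) : Prop :=
  (forall t, 0 <= f t) /\ \sum_(t : T) f t = 1.

Definition quantile (R : realType) (mu : set R -> \bar R) (tau : R) : R :=
  inf [set z : R | (tau%:E <= mu [set` `]-oo, z]])%E].

(* quantile levels tau_k = (2k-1)/(2K), k = 1..K, indexed by i : 'I_K (k = i+1) *)
Definition tau_lvl (R : realType) (K : nat) (i : 'I_K) : R :=
  (2 * i.+1 - 1)%:R / (2 * K)%:R.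

Definition proj_W1 (R : realType) (K : nat) (mu : set R -> \bar R) : set R -> \bar R :=
  fun B => (\sum_(i < K) (K%:R^-1)%:E * \d_(quantile mu (tau_lvl R i)) B)%E.

Definition qdist (R : realType) (X A : finType) (K : nat) (z : X -> A -> 'I_K -> R)
  : X -> A -> set R -> \bar R :=
  fun x a B => (\sum_(i < K) (K%:R^-1)%:E * \d_(z x a i) B)%E.

Definition bellman (R : realType) (X A : finType)
  (p : X -> A -> X -> R) (pi : X -> A -> R) (Rdist : X -> A -> probability R R)
  (gamma : R) (eta : X -> A -> set R -> \bar R) : X -> A -> set R -> \bar R :=
  fun x a B => (\sum_(x' : X) \sum_(a' : A)
     (p x a x' * pi x' a')%:E *
       \int[Rdist x a]_r eta x' a' ((fun z : R => (r + gamma * z)%R) @^-1` B))%E.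

(* (Xs, As, Rs) on the probability space P is a realisation of the MDP under
   policy pi started from X_0 = x, A_0 = a: the finite-dimensional joint laws are
   P(X_t = x_t, A_t = a_t, R_t in B_t for all t <= n)
     = [x_0 = x][a_0 = a] prod_{t<=n} R(B_t | x_t,a_t)
                          prod_{t<n} p(x_{t+1}|x_t,a_t) pi(a_{t+1}|x_{t+1}). *)
Definition mdp_process (R : realType) (X A : finType)
  (p : X -> A -> X -> R) (pi : X -> A -> R) (Rdist : X -> A -> probability R R)
  (x : X) (a : A) (d : measure_display) (T : measurableType d) (P : probability T R)
  (Xs : nat -> T -> X) (As : nat -> T -> A) (Rs : nat -> T -> R) : Prop :=
  (forall t (y : X), measurable [set w | Xs t w = y]) /\
  (forall t (b : A), measurable [set w | As t w = b]) /\
  (forall t, measurable_fun setT (Rs t)) /\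
  forall (n : nat) (xs : nat -> X) (as_ : nat -> A) (Bs : nat -> set R),
    (forall t, measurable (Bs t)) ->
    P [set w | forall t, (t <= n)%N ->
                 [/\ Xs t w = xs t, As t w = as_ t & Bs t (Rs t w)]]
    = (((xs 0%N == x) && (as_ 0%N == a))%:R%:E
       * (\prod_(t < n.+1) Rdist (xs t) (as_ t) (Bs t))
       * (\prod_(t < n) (p (xs t) (as_ t) (xs t.+1) * pi (xs t.+1) (as_ t.+1))%:E))%E.

Definition disc_return (R : realType) (T : Type) (gamma : R) (Rs : nat -> T -> R) : T -> R :=
  fun w => limn (fun n => \sum_(t < n) gamma ^+ t * Rs t w).

Definition return_law (R : realType) (d : measure_display) (T : measurableType d)
  (P : probability T R) (gamma : R) (Rs : nat -> T -> R) : set R -> \bar R :=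
  fun B => P (disc_return gamma Rs @^-1` B).

(* Main.v *)
Require Import Defs.
From HB Require Import structures.
From mathcomp Require Import all_boot all_order all_algebra.
From mathcomp Require Import all_classical all_reals all_analysis.
From mathcomp Require Import measurable_realfun.
From mathcomp Require Import ring lra zify.
Import Order.TTheory GRing.Theory Num.Theory.
Import numFieldNormedType.Exports.
Local Open Scope classical_set_scope.
Local Open Scope ring_scope.

Set Implicit Arguments. Unset Strict Implicit. Unset Printing Implicit Defensive.

(** Let D = Rmax/(1-gamma); all distributions involved live on [-D,D]. Replacing
    such a distribution by the uniform one on its K midpoint quantiles changes
    the integral of an L-Lipschitz function by at most L D/K, because the two
    CDFs differ by at most 1/(2K) (up to an arbitrarily small shift). Hence a
    fixed point eta of the projected operator is within L D/K of T eta when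
    tested against f. Unfolding the process one reward at a time replaces f by
    f(r + gamma .), which is L gamma-Lipschitz, so these errors sum to
    |E f(return) - eta(f)| <= L D/(K (1-gamma)). A Kantorovich potential turns
    the sum of the quantile gaps into such a difference of integrals, and the
    total is D/K + D/(K (1-gamma)), which is below the stated bound. *)

(** * Lipschitz test functions and quantile projection *)

(** The map Pi_W1 is not nonexpansive in W1, so the projected operator is not iterated in that
    metric: only the residual between eta and T eta is estimated, and the geometric factor comes
    from the shrinking Lipschitz constants. The process is known only through finite-dimensional
    laws, under which a prescribed reward value may have probability zero. Rewards are therefore cut
    into cells of width [del], and estimates are weighted by the probability of a history instead of
    being conditioned on it. Two further obstacles: rewards are bounded only almost surely, and the
    atoms of eta come in arbitrary order with no bound given in advance. *)

Definition lip (R : realType) (L : R) (f : R -> R) :=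
  forall x y, `|f x - f y| <= L * `|x - y|.

Lemma lip_ge0 (R : realType) (L : R) (f : R -> R) : lip L f -> 0 <= L.
Proof.
move=> /(_ 1 0); rewrite subr0 normr1 mulr1; exact: le_trans.
Qed.

Lemma lip_affine (R : realType) (L c g : R) (f : R -> R) :
  0 <= g -> lip L f -> lip (L * g) (fun y => f (c + g * y)).
Proof.
move=> g0 fL x y; apply: (le_trans (fL _ _)).
have -> : c + g * x - (c + g * y) = g * (x - y) by ring.
by rewrite normrM (ger0_norm g0) mulrA.
Qed.

(** Node 0 lies at -D - del, strictly below -D, so a distribution function vanishes there even if -D
    carries an atom. Telescoping sums then have no boundary term. *)
Definition grid (R : realType) (D del : R) (j : nat) : R := j%:R * del - del - D.

Lemma grid_step (R : realType) (D del : R) (j : nat) :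
  grid D del j.+1 - grid D del j = del.
Proof. by rewrite /grid -natr1; ring. Qed.

Lemma grid_cover (R : realType) (D del : R) :
  0 < del -> exists N, D <= grid D del N /\ N%:R * del <= 2 * `|D| + 2 * del.
Proof.
(* Of the two extra cells, one undoes the offset of node 0 and the other makes up for truncation. *)
move=> d0; exists (Num.truncn (2 * `|D| / del)).+2.
have h : 0 <= 2 * `|D| / del by rewrite divr_ge0 ?mulr_ge0// ltW.
have /andP[h1 h2] := truncn_itv h.
rewrite ler_pdivlMr// in h1; rewrite ltr_pdivrMr// in h2.
have := ler_norm D.
by rewrite /grid; move: h1 h2; rewrite -!natr1; lra.
Qed.

Definition grid_sum (R : realType) (D del : R) (N : nat) (F f : R -> R) : R :=
  \sum_(j < N) f (grid D del j) * (F (grid D del j.+1) - F (grid D del j)).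

Definition is_cdf (R : realType) (D : R) (F : R -> R) :=
  [/\ {homo F : x y / x <= y}, forall y, y < - D -> F y = 0
    & forall y, D <= y -> F y = 1].

(* The functional [I] integrates against the distribution with CDF [F]: this
   Riemann-Stieltjes estimate is all that is used of an expectation. *)
Definition integrates (R : realType) (D : R) (F : R -> R) (I : (R -> R) -> R) :=
  forall L f del N, lip L f -> 0 < del -> D <= grid D del N ->
    `|I f - grid_sum D del N F f| <= L * del.

(** All increments of the step function vanish except over the cell containing x; there f differs
    from its left endpoint value by at most L del. *)
Lemma integrates_pt (R : realType) (D x : R) :
  `|x| <= D -> integrates D (fun y => (x <= y)%R%:R) (fun f => f x).
Proof.
move=> xD L f del N fL d0 DN.
have /andP[xD1 xD2] : - D <= x <= D by rewrite -ler_norml.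
pose c (j : nat) : R := (x <= grid D del j)%R%:R.
have sumc : \sum_(j < N) (c j.+1 - c j) = 1.
  rewrite -(big_mkord xpredT (fun j => c j.+1 - c j)) telescope_sumr// /c.
  rewrite (le_trans xD2 DN) [x <= grid _ _ 0]leNgt.
  suff -> : grid D del 0 < x by rewrite subr0.
  by rewrite /grid; lra.
have -> : f x - grid_sum D del N (fun y => (x <= y)%R%:R) f =
    \sum_(j < N) (f x - f (grid D del j)) * (c j.+1 - c j).
  rewrite -{1}[f x]mulr1 -[X in f x * X]sumc mulr_sumr -sumrB.
  by apply: eq_bigr => j _; rewrite mulrBl.
rewrite -[L * del]mulr1 -[X in _ * del * X]sumc mulr_sumr (le_trans (ler_norm_sum _ _ _))//.
apply: ler_sum => j _; rewrite normrM.
have := grid_step D del j; rewrite /c.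
have [xj|xj] := leP x (grid D del j).
  move=> s; have -> : x <= grid D del j.+1 by lra.
  by rewrite subrr normr0 !mulr0.
have [xj1|xj1] := leP x (grid D del j.+1); last by rewrite subrr normr0 !mulr0.
move=> s; rewrite subr0 normr1 !mulr1 (le_trans (fL _ _))//.
apply: ler_wpM2l; first exact: lip_ge0 fL.
by rewrite ger0_norm; lra.
Qed.

Lemma integrates_mix (R : realType) (D : R) (T : finType) (w : T -> R)
    (F : T -> R -> R) (I : T -> (R -> R) -> R) :
  is_fdist w -> (forall t, integrates D (F t) (I t)) ->
  integrates D (fun y => \sum_t w t * F t y) (fun f => \sum_t w t * I t f).
Proof.
move=> [w0 w1] FI L f del N fL d0 DN.
have -> : grid_sum D del N (fun y => \sum_t w t * F t y) f =
    \sum_t w t * grid_sum D del N (F t) f.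
  rewrite /grid_sum; under eq_bigr do rewrite -sumrB mulr_sumr.
  rewrite exchange_big/=; apply: eq_bigr => t _; rewrite mulr_sumr.
  by apply: eq_bigr => j _; ring.
rewrite -sumrB -[L * del]mul1r -w1 mulr_suml.
rewrite (le_trans (ler_norm_sum _ _ _))//; apply: ler_sum => t _.
by rewrite -mulrBr normrM (ger0_norm (w0 t)) ler_wpM2l// FI.
Qed.

Lemma is_cdf_mix (R : realType) (D : R) (T : finType) (w : T -> R)
    (F : T -> R -> R) :
  is_fdist w -> (forall t, is_cdf D (F t)) ->
  is_cdf D (fun y => \sum_t w t * F t y).
Proof.
move=> [w0 w1] Fc; split=> [x y xy|y yD|y yD].
- by apply: ler_sum => t _; rewrite ler_wpM2l//; have [->] := Fc t.
- by apply: big1 => t _; have [_ -> // _] := Fc t; rewrite mulr0.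
- by rewrite -w1; apply: eq_bigr => t _; have [_ _ ->] := Fc t; rewrite ?mulr1.
Qed.

Lemma is_cdf_pt (R : realType) (D x : R) :
  `|x| <= D -> is_cdf D (fun y => (x <= y)%R%:R).
Proof.
rewrite ler_norml => /andP[xD1 xD2]; split=> [y y' yy'|y yD|y yD].
- have [xy|//] := leP x y; first by rewrite (le_trans xy yy').
- by rewrite leNgt (lt_le_trans yD xD1).
- by rewrite (le_trans xD2 yD).
Qed.

Lemma cdf_itv01 (R : realType) (D : R) (F : R -> R) y : is_cdf D F -> 0 <= F y <= 1.
Proof.
move=> [Fm F0 F1]; apply/andP; split.
  have [yD|yD] := ltP y (- D); first by rewrite F0.
  by rewrite -(F0 (- D - 1)) ?Fm//; lra.
have [yD|yD] := leP D y; first by rewrite F1.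
by rewrite -(F1 D) ?Fm// ltW.
Qed.

(** In a sorted family the indices of the atoms below a level form an initial segment, determined by
    its cardinality. Values of an atomic CDF thus become comparisons of indices. *)
Lemma mem_down_closed (K : nat) (A : {set 'I_K}) :
  (forall i j : 'I_K, (i <= j)%N -> j \in A -> i \in A) ->
  forall i, (i \in A) = (i < #|A|)%N.
Proof.
move=> dA i; have card_le (j : 'I_K) : #|[set k : 'I_K | (k < j)%N]%SET| = j.
  rewrite -sum1dep_card (big_ord_narrow (ltnW (ltn_ord j))) sum1_card card_ord//.
apply/idP/idP => [iA|].
  have : [set k : 'I_K | (k < i)%N]%SET \proper A.
    rewrite properE; apply/andP; split.
      by apply/fintype.subsetP => k; rewrite inE => /ltnW ki; exact: dA ki iA.
    by apply/negP => /fintype.subsetP/(_ _ iA); rewrite inE ltnn.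
  by move=> /proper_card; rewrite card_le.
apply: contraLR => iA; rewrite -leqNgt -[leqRHS]card_le; apply: subset_leq_card.
apply/fintype.subsetP => k kA; rewrite inE ltnNge; apply: contra iA => ik.
exact: dA ik kA.
Qed.

(** * Midpoint levels and quantiles of a distribution function *)

Section quantiles.
Context (R : realType) (K : nat).
Hypothesis hK : (0 < K)%N.

Lemma tau_lvlE (i : 'I_K) : tau_lvl R i = (i%:R + 2^-1) / K%:R.
Proof.
rewrite /tau_lvl; have K0 : K%:R != 0 :> R by rewrite pnatr_eq0 -lt0n.
have -> : (2 * i.+1 - 1 = 2 * i + 1)%N by lia.
by rewrite natrD !natrM; field.
Qed.

Lemma tau_lvl_le (i j : 'I_K) : (i <= j)%N -> tau_lvl R i <= tau_lvl R j.
Proof.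
move=> ij; rewrite !tau_lvlE ler_pM2r ?invr_gt0 ?ltr0n//.
by rewrite lerD2r ler_nat.
Qed.

Lemma tau_lvl_gt0 (i : 'I_K) : 0 < tau_lvl R i.
Proof. by rewrite tau_lvlE divr_gt0 ?ltr0n// ltr_wpDl// invr_gt0. Qed.

Lemma tau_lvl_lt1 (i : 'I_K) : tau_lvl R i < 1.
Proof.
rewrite tau_lvlE ltr_pdivrMr ?ltr0n// mul1r.
have : i.+1%:R <= K%:R :> R by rewrite ler_nat.
by rewrite -natr1; lra.
Qed.

End quantiles.

Definition uniform_fdist (R : realType) (K : nat) (i : 'I_K) : R := K%:R^-1.

Lemma is_fdist_uniform (R : realType) (K : nat) :
  (0 < K)%N -> is_fdist (@uniform_fdist R K).
Proof.
move=> K0; split=> [i|]; first by rewrite invr_ge0.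
by rewrite sumr_const card_ord -[LHS]mulr_natr mulVf// pnatr_eq0 -lt0n.
Qed.

Definition cdf_quantile (R : realType) (F : R -> R) (tau : R) : R :=
  inf [set y | tau <= F y].

Section cdf_quantile.
Context (R : realType) (D : R) (F : R -> R).
Hypothesis Fc : is_cdf D F.

Lemma cdf_quantile_has_inf tau : 0 < tau <= 1 -> has_inf [set y | tau <= F y].
Proof.
have [Fm F0 F1] := Fc; move=> /andP[t0 t1]; split.
  by exists D => /=; rewrite F1.
exists (- D) => y /=; rewrite leNgt [X in _ -> is_true X]leNgt.
by apply: contra => yD; rewrite F0.
Qed.

Lemma cdf_quantile_le tau y : 0 < tau <= 1 -> tau <= F y -> cdf_quantile F tau <= y.
Proof. by move=> /cdf_quantile_has_inf[_ h] ty; exact: ge_inf. Qed.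

(** [is_cdf] does not include right-continuity, so the infimum may fail to be attained and the level
    is known to be reached only strictly to the right of the quantile. *)
Lemma cdf_quantile_lt tau y : 0 < tau <= 1 -> cdf_quantile F tau < y -> tau <= F y.
Proof.
move=> /cdf_quantile_has_inf[h _] /(inf_lt h)[x /= tx xy].
by rewrite (le_trans tx)//; have [-> //] := Fc; exact: ltW.
Qed.

Lemma cdf_quantile_bound tau : 0 < tau <= 1 -> `|cdf_quantile F tau| <= D.
Proof.
have [Fm F0 F1] := Fc; move=> t01; have /andP[t0 t1] := t01.
rewrite ler_norml; apply/andP; split; last by rewrite cdf_quantile_le// F1.
have [h _] := cdf_quantile_has_inf t01; apply: lb_le_inf => // y /=.
rewrite leNgt [X in _ -> is_true X]leNgt.
by apply: contra => yD; rewrite F0.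
Qed.

Lemma cdf_quantile_mono tau tau' : 0 < tau -> tau <= tau' -> tau' <= 1 ->
  cdf_quantile F tau <= cdf_quantile F tau'.
Proof.
move=> t0 tt' t1; have t'0 : 0 < tau' <= 1 by rewrite (lt_le_trans t0 tt').
have [h _] := cdf_quantile_has_inf t'0; apply: lb_le_inf => // y /= ty.
by apply: cdf_quantile_le; [rewrite t0 (le_trans tt')|exact: le_trans ty].
Qed.

End cdf_quantile.

Section monotone_atoms.
Context (R : realType) (K : nat) (q : 'I_K -> R).
Hypothesis hK : (0 < K)%N.
Hypothesis qm : forall i j : 'I_K, (i <= j)%N -> q i <= q j.

Definition atomic_cdf (y : R) : R := \sum_i uniform_fdist R i * (q i <= y)%R%:R.

Lemma atomic_cdfE y : atomic_cdf y = #|[set i | (q i <= y)%R]%SET|%:R / K%:R.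
Proof.
rewrite /atomic_cdf -mulr_sumr mulrC -sum1dep_card natr_sum [in RHS]big_mkcond/=.
by congr (_ / _); apply: eq_bigr => i _; case: (q i <= y).
Qed.

Lemma le_atom_card y i : (q i <= y) = (i < #|[set i | (q i <= y)%R]%SET|)%N.
Proof.
rewrite -mem_down_closed ?inE// => j k jk; rewrite !inE; exact: le_trans (qm jk).
Qed.

(* The atoms of a uniform K-atomic distribution are its own quantiles at the
   midpoints [tau_lvl]. *)
Lemma tau_lvl_le_atomic_cdf y i : (tau_lvl R i <= atomic_cdf y) = (q i <= y).
Proof.
rewrite tau_lvlE// atomic_cdfE le_atom_card ler_pM2r ?invr_gt0 ?ltr0n//.
set m := #|_|; have [im|mi] := ltnP i m.
  have : i.+1%:R <= m%:R :> R by rewrite ler_nat.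
  by rewrite -natr1; lra.
have : m%:R <= i%:R :> R by rewrite ler_nat.
by lra.
Qed.

Lemma cdf_quantile_atomic i : cdf_quantile atomic_cdf (tau_lvl R i) = q i.
Proof.
rewrite /cdf_quantile.
have -> : [set y | tau_lvl R i <= atomic_cdf y] = `[q i, +oo[%classic.
  by apply/seteqP; split=> y /=; rewrite tau_lvl_le_atomic_cdf in_itv/= andbT.
exact: inf_itv.
Qed.

End monotone_atoms.

Section quantile_projection.
Context (R : realType) (K : nat) (D : R) (F : R -> R).
Hypothesis hK : (0 < K)%N.
Hypothesis Fc : is_cdf D F.
Let q (i : 'I_K) : R := cdf_quantile F (tau_lvl R i).

Let tau01 (i : 'I_K) : 0 < tau_lvl R i <= 1.
Proof. by rewrite tau_lvl_gt0//= ltW// tau_lvl_lt1. Qed.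

Lemma quantile_proj_mono (i j : 'I_K) : (i <= j)%N -> q i <= q j.
Proof.
move=> ij; apply: (cdf_quantile_mono Fc); rewrite ?tau_lvl_gt0 ?tau_lvl_le//.
by have /andP[] := tau01 j.
Qed.

(** If m < K atoms lie at or below y, the quantile of index m lies beyond y, so F y < (m + 1/2)/K.
    If m = K, the bound F <= 1 suffices. *)
Lemma cdf_le_atomic y : F y <= atomic_cdf q y + (2 * K%:R)^-1.
Proof.
have K0 : 0 < K%:R :> R by rewrite ltr0n.
rewrite atomic_cdfE; set m := #|_|.
have := max_card [set i | (q i <= y)%R]%SET; rewrite card_ord -/m leq_eqVlt.
case/predU1P => [->|mK].
  rewrite divff ?gt_eqF//; have /andP[_] := cdf_itv01 y Fc; move/le_trans; apply.
  by rewrite lerDl invr_ge0; lra.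
have : ~~ (q (Ordinal mK) <= y).
  by rewrite (le_atom_card quantile_proj_mono) /= ltnn.
rewrite -ltNge => yq; have : ~~ (tau_lvl R (Ordinal mK) <= F y).
  by rewrite -ltNge ltNge; apply: contraTN yq => /(cdf_quantile_le Fc (tau01 _)); rewrite -leNgt.
rewrite -ltNge tau_lvlE//= => /ltW/le_trans; apply.
by rewrite le_eqVlt; apply/orP; left; apply/eqP; field; rewrite gt_eqF.
Qed.

(** The last atom counted has index m - 1 and level (m - 1/2)/K, which F has reached strictly to the
    right of that atom. The shift is later one grid cell. *)
Lemma atomic_le_cdf y y' : y < y' -> atomic_cdf q y <= F y' + (2 * K%:R)^-1.
Proof.
move=> yy'; have K0 : 0 < K%:R :> R by rewrite ltr0n.
rewrite atomic_cdfE; set m := #|_|.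
have := max_card [set i | (q i <= y)%R]%SET; rewrite card_ord -/m.
have [-> _|m0 mK] := posnP m.
  have /andP[F0 _] := cdf_itv01 y' Fc.
  by rewrite mul0r addr_ge0// invr_ge0 mulr_ge0// ltW.
have m1K : (m.-1 < K)%N by rewrite prednK.
have : q (Ordinal m1K) <= y.
  by rewrite (le_atom_card quantile_proj_mono) /= prednK.
move=> /le_lt_trans/(_ yy')/(cdf_quantile_lt Fc (tau01 _)).
rewrite tau_lvlE//= -lerBlDr; apply: le_trans.
rewrite -{1}(prednK m0) -natr1 le_eqVlt; apply/orP; left; apply/eqP; field.
by rewrite gt_eqF.
Qed.

(** Summation by parts moves the difference onto H = F - [atomic_cdf q], which is at most 1/(2K) up
    to the increment of F over the next cell. The grid has length about 2D, hence the constant D/K;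
    the increments of F telescope to at most 1 and cost only L del. *)
Lemma quantile_proj_error (I : (R -> R) -> R) (L : R) (f : R -> R) :
  integrates D F I -> lip L f ->
  `|I f - \sum_i uniform_fdist R i * f (q i)| <= L * (D / K%:R).
Proof.
move=> FI fL; have K0 : 0 < K%:R :> R by rewrite ltr0n.
have K1 : 1 <= K%:R :> R by rewrite (ler_nat R 1).
have L0 := lip_ge0 fL.
have qD i : `|q i| <= D by exact: cdf_quantile_bound.
have D0 : 0 <= D by have [i _] : exists i : 'I_K, true by [exists (Ordinal hK)]; exact: le_trans (qD i).
have uK := is_fdist_uniform R hK.
have qI : integrates D (atomic_cdf q) (fun f => \sum_i uniform_fdist R i * f (q i)).
  exact: (integrates_mix uK (fun i => integrates_pt (qD i))).
have [_ q0 q1] : is_cdf D (atomic_cdf q).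
  exact: (is_cdf_mix uK (fun i => is_cdf_pt (qD i))).
have [Fm F0 F1] := Fc.
(* Discretisation costs 4 L del: L del for each of the two integrals and 2 L del in [key]. The
   denominator has L + 1 since L may be 0. *)
apply/ler_addgt0Pr => e e0; pose del := e / (4 * (L + 1)).
have d0 : 0 < del by rewrite divr_gt0//; lra.
have [N [DN Nd]] := grid_cover D d0.
pose b j := grid D del j; pose H j := F (b j) - atomic_cdf q (b j).
have H0 : H 0%N = 0.
  by rewrite /H F0 ?q0 ?subrr// /b /grid; lra.
have HN : H N = 0 by rewrite /H F1 ?q1 ?subrr.
have Hle j : `|H j| <= (2 * K%:R)^-1 + (F (b j.+1) - F (b j)).
  have s := grid_step D del j.
  have h1 := cdf_le_atomic (b j).
  have h2 : atomic_cdf q (b j) <= F (b j.+1) + (2 * K%:R)^-1.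
    by apply: atomic_le_cdf; rewrite /b; lra.
  have h3 : F (b j) <= F (b j.+1) by apply: Fm; rewrite /b; lra.
  by rewrite ler_norml /H; lra.
have key : `|grid_sum D del N F f - grid_sum D del N (atomic_cdf q) f|
    <= L * (D / K%:R) + 2 * (L * del).
  have -> : grid_sum D del N F f - grid_sum D del N (atomic_cdf q) f =
      - \sum_(j < N) (f (b j.+1) - f (b j)) * H j.+1.
    apply/eqP; rewrite -addr_eq0 -sumrB -big_split/=; apply/eqP.
    rewrite (eq_bigr (fun j : 'I_N => f (b j.+1) * H j.+1 - f (b j) * H j)).
      rewrite -(big_mkord xpredT (fun j => f (b j.+1) * H j.+1 - f (b j) * H j)).
      by rewrite telescope_sumr// H0 HN !mulr0 subrr.
    by move=> j _; rewrite /H /b; ring.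
  rewrite normrN (le_trans (ler_norm_sum _ _ _))//.
  apply: (@le_trans _ _ (\sum_(j < N) L * del *
     ((2 * K%:R)^-1 + (F (b j.+2) - F (b j.+1))))).
    apply: ler_sum => j _; rewrite normrM ler_pM//.
    by rewrite (le_trans (fL _ _))// grid_step gtr0_norm.
  rewrite -mulr_sumr big_split/= sumr_const card_ord.
  rewrite -(big_mkord xpredT (fun j => F (b j.+2) - F (b j.+1))).
  rewrite telescope_sumr//.
  have /andP[F10 _] := cdf_itv01 (b 1%N) Fc.
  have /andP[_ FN1] := cdf_itv01 (b N.+1) Fc.
  rewrite mulrDr -mulr_natr.
  have h : L * del * (F (b N.+1) - F (b 1%N)) <= L * del.
    by rewrite ler_piMr ?(mulr_ge0 L0 (ltW d0))//; lra.
  rewrite ger0_norm// in Nd.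
  have h' : L * del * ((2 * K%:R)^-1 * N%:R) <= L * (D / K%:R) + L * del.
    have -> : L * del * ((2 * K%:R)^-1 * N%:R) = L * (N%:R * del * (2 * K%:R)^-1) by ring.
    rewrite -mulrDr ler_wpM2l// ler_pdivrMr ?mulr_gt0//.
    rewrite mulrDl.
    have -> : D / K%:R * (2 * K%:R) = 2 * D by field; rewrite gt_eqF.
    have : del <= del * K%:R by rewrite ler_peMr// ltW.
    by lra.
  by lra.
have i1 := FI _ _ _ _ fL d0 DN; have i2 := qI _ _ _ _ fL d0 DN.
have Ld : 4 * (L * del) <= e.
  rewrite /del; have -> : 4 * (L * (e / (4 * (L + 1)))) = L / (L + 1) * e.
    by field; lra.
  by rewrite ler_piMl ?(ltW e0)// ler_pdivrMr ?mul1r; lra.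
move: i1 i2 key; rewrite !ler_distl => /andP[? ?] /andP[? ?] /andP[? ?].
by apply/andP; split; lra.
Qed.

End quantile_projection.

(** * Kantorovich potential of two monotone families *)

Section kantorovich_potential.
Context (R : realType) (K : nat) (q s : 'I_K -> R).
Hypothesis qm : forall i j : 'I_K, (i <= j)%N -> q i <= q j.
Hypothesis sm : forall i j : 'I_K, (i <= j)%N -> s i <= s j.
Let leb : set R -> \bar R := @lebesgue_measure R.

Let len (U : set R) (x y : R) : R := fine (leb (U `&` `]x, y])).

Let len_itv x y : x <= y -> leb `]x, y] = (y - x)%:E.
Proof.
move=> xy; rewrite /leb lebesgue_measure_itv/= lte_fin.
have [//|yx] := ltP x y.
by have -> : y = x; [apply/eqP; rewrite eq_le yx|rewrite subrr].
Qed.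

Let len_le U x y : measurable U -> x <= y -> 0 <= len U x y <= y - x.
Proof.
move=> mU xy; have h : (leb (U `&` `]x, y]) <= (y - x)%:E)%E.
  rewrite -len_itv//; apply: le_measure; rewrite ?inE//.
  exact: measurableI.
apply/andP; split; first by rewrite fine_ge0.
have h0 : (0 <= leb (U `&` `]x, y]))%E by exact: measure_ge0.
by rewrite -lee_fin fineK// ge0_fin_numE// (le_lt_trans h) ?ltry.
Qed.

Let lenD U x y z : measurable U -> x <= y -> y <= z ->
  len U x z = len U x y + len U y z.
Proof.
move=> mU xy yz.
have fin a b : a <= b -> leb (U `&` `]a, b]) \is a fin_num.
  move=> ab; have h0 : (0 <= leb (U `&` `]a, b]))%E by exact: measure_ge0.
  rewrite ge0_fin_numE// (@le_lt_trans _ _ (leb `]a, b]))//; last by rewrite len_itv// ltry.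
  apply: le_measure; rewrite ?inE//; exact: measurableI.
rewrite /len -fineD ?fin//; congr fine; rewrite /leb -measureU//; first last.
- apply/seteqP; split=> // t []; rewrite /= !in_itv/= => -[_ /andP[_ ty]] [_ /andP[yt _]].
  by move: yt; rewrite ltNge ty.
- exact: measurableI.
- exact: measurableI.
rewrite -setIUr; congr (_ _ (_ `&` _)); apply/seteqP; split=> t /=; rewrite !in_itv/=.
  by move=> /andP[xt tz]; have [ty|ty] := leP t y; [left|right]; rewrite ?xt ?tz.
by case=> /andP[h1 h2]; rewrite ?(le_trans h2 yz) ?(le_lt_trans xy h1) ?h1 ?h2.
Qed.

(** f is a primitive of 1_U - 1_V, where U and V collect the intervals on which q_i exceeds s_i and
    conversely. Both families being sorted, U and V are disjoint, so f is 1-Lipschitz and moves at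
    unit speed between s_i and q_i, with the larger value at q_i. One f thus serves all i. *)
Lemma kantorovich_potential :
  exists f, lip 1 f /\ forall i, f (q i) - f (s i) = `|q i - s i|.
Proof.
pose U : set R := \bigcup_i `]s i, q i]%classic.
pose V : set R := \bigcup_i `]q i, s i]%classic.
have mU : measurable U by apply: fin_bigcup_measurable => //; exact: finite_finset.
have mV : measurable V by apply: fin_bigcup_measurable => //; exact: finite_finset.
have UV t : U t -> V t -> False.
  move=> [i _ /= h1] [j _ /= h2].
  move: h1 h2; rewrite !in_itv/= => /andP[s1 q1] /andP[q2 s2].
  have [ij|ji] := leqP i j.
    by have := qm ij; lra.
  by have := sm (ltnW ji); lra.
(* Signed primitive based at 0: one of the two terms is always the measure of an empty
   intersection. *)
pose prim W x := len W 0 x - len W x 0.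
have len0 W x y : y <= x -> len W x y = 0.
  move=> yx; rewrite /len; suff -> : W `&` `]x, y] = set0 by rewrite /leb measure0.
  apply/seteqP; split=> // t [_]; rewrite /= in_itv/= => /andP[xt ty].
  by move: (lt_le_trans xt ty); rewrite ltNge yx.
have primB W x y : measurable W -> x <= y -> prim W y - prim W x = len W x y.
  move=> mW xy; rewrite /prim.
  have [x0|x0] := leP 0 x.
    rewrite (len0 _ x 0)// (len0 _ y 0) ?(le_trans x0)//.
    by rewrite (@lenD _ 0 x y)//; ring.
  have [y0|y0] := leP 0 y.
    rewrite (len0 _ 0 x) ?(ltW x0)// (len0 _ y 0)// (@lenD _ x 0 y) ?(ltW x0)//; ring.
  by rewrite (len0 _ 0 x) ?(len0 _ 0 y) ?(@lenD _ x y 0) ?(ltW x0) ?(ltW y0)//; ring.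
pose f x := prim U x - prim V x.
have fB x y : x <= y -> f y - f x = len U x y - len V x y.
  by move=> xy; rewrite -!primB// /f; ring.
have full (W W' : set R) (x y : R) : measurable W -> x <= y ->
    (forall t, W t -> W' t -> False) -> `]x, y] `<=` W ->
    len W x y = y - x /\ len W' x y = 0.
  move=> mW xy WW' sW; rewrite /len; split.
    by rewrite setIC (setIidl sW) len_itv.
  suff -> : W' `&` `]x, y] = set0 by rewrite /leb measure0.
  by apply/seteqP; split=> // t [W't /sW Wt]; exact: (WW' t).
exists f; split=> [|i].
  have half x y : x <= y -> `|f y - f x| <= 1 * `|y - x|.
    move=> xy; rewrite fB// mul1r [leRHS]ger0_norm ?subr_ge0//.
    have := len_le mU xy; have := len_le mV xy; rewrite ler_norml; lra.
  move=> x y; have [xy|/ltW yx] := leP x y; last exact: half.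
  by rewrite distrC (distrC x); exact: half.
have [sq|/ltW qs] := leP (s i) (q i).
  have [||] := full U V _ _ mU sq; first exact: UV.
    by move=> t /= ht; exists i.
  by move=> u v; rewrite fB// u v subr0 ger0_norm ?subr_ge0.
have [||] := full V U _ _ mV qs; first by move=> t h h'; exact: UV h' h.
  by move=> t /= ht; exists i.
move=> u v; rewrite distrC -opprB fB// u v ger0_norm ?subr_ge0//; ring.
Qed.

End kantorovich_potential.

(** * Expectations of bounded random variables *)

Lemma lip_measurable (R : realType) (L : R) (f : R -> R) :
  lip L f -> measurable_fun setT f.
Proof.
move=> fL; apply: continuous_measurable_fun => x.
apply/cvgrPdist_le => /= e e0; have L0 := lip_ge0 fL.
apply/nbhs_ballP; exists (e / (L + 1)) => /=; first by rewrite divr_gt0//; lra.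
move=> y; rewrite /ball_ /= ltr_pdivlMr; last by lra.
have := fL x y; have := normr_ge0 (x - y); lra.
Qed.

Section bounded_expectation.
Context d (T : measurableType d) (R : realType) (P : probability T R).

Definition bounded_rv (f : T -> R) :=
  measurable_fun setT f /\ exists C, forall w, `|f w| <= C.

Lemma bounded_rv_integrable f : bounded_rv f -> P.-integrable setT (EFin \o f).
Proof.
move=> [mf [C fC]]; apply: measurable_bounded_integrable => //.
  by have h : (P setT < +oo)%E; [rewrite probability_setT ltry|exact: h].
exists C; split; first exact: num_real.
by move=> M CM w _ /=; rewrite (le_trans (fC w))// ltW.
Qed.

Lemma bounded_rvD f g : bounded_rv f -> bounded_rv g -> bounded_rv (fun w => f w + g w).
Proof.
move=> [mf [C fC]] [mg [C' gC]]; split; first exact: measurable_funD.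
by exists (C + C') => w; rewrite (le_trans (ler_normD _ _))// lerD.
Qed.

Lemma bounded_rvM f g : bounded_rv f -> bounded_rv g -> bounded_rv (fun w => f w * g w).
Proof.
move=> [mf [C fC]] [mg [C' gC]]; split; first exact: measurable_funM.
by exists (C * C') => w; rewrite normrM ler_pM.
Qed.

Lemma bounded_rv_cst c : bounded_rv (fun=> c).
Proof. by split; [exact: measurable_cst|exists `|c|]. Qed.

Lemma bounded_rv_indic (A : set T) : measurable A -> bounded_rv \1_A.
Proof.
move=> mA; split; first exact: measurable_indic.
by exists 1 => w; rewrite indicE; case: (w \in A); rewrite ?normr1 ?normr0.
Qed.

Lemma bounded_rv_sum (I : Type) (r : seq I) (f : I -> T -> R) :
  (forall i, bounded_rv (f i)) -> bounded_rv (fun w => \sum_(i <- r) f i w).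
Proof.
move=> fb; elim: r => [|i r IH].
  by under eq_fun do rewrite big_nil; exact: bounded_rv_cst.
by under eq_fun do rewrite big_cons; exact: bounded_rvD.
Qed.

Lemma bounded_rv_lip (L : R) (f : R -> R) (g : T -> R) D : lip L f -> measurable_fun setT g ->
  (forall w, `|g w| <= D) -> bounded_rv (f \o g).
Proof.
move=> fL mg gD; split; first exact: measurableT_comp (lip_measurable fL) mg.
exists (`|f 0| + L * D) => w /=.
rewrite -[f (g w)](subrK (f 0)) addrC (le_trans (ler_normD _ _))// lerD2l.
by rewrite (le_trans (fL _ _))// subr0 ler_wpM2l// (lip_ge0 fL).
Qed.

Lemma RintegralT_D f g : bounded_rv f -> bounded_rv g ->
  \int[P]_w (f w + g w) = \int[P]_w f w + \int[P]_w g w.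
Proof. by move=> bf bg; rewrite RintegralD//; exact: bounded_rv_integrable. Qed.

Lemma RintegralT_Zl c f : bounded_rv f -> \int[P]_w (c * f w) = c * \int[P]_w f w.
Proof. by move=> bf; rewrite RintegralZl//; exact: bounded_rv_integrable. Qed.

Lemma RintegralT_sum (I : Type) (r : seq I) (f : I -> T -> R) :
  (forall i, bounded_rv (f i)) ->
  \int[P]_w (\sum_(i <- r) f i w) = \sum_(i <- r) \int[P]_w f i w.
Proof.
move=> fb; elim: r => [|i r IH].
  under eq_Rintegral do rewrite big_nil.
  by rewrite Rintegral_cst// mul0r big_nil.
under eq_Rintegral do rewrite big_cons.
by rewrite RintegralT_D ?IH ?big_cons//; exact: bounded_rv_sum.
Qed.

Lemma RintegralT_indic (A : set T) : measurable A -> \int[P]_w \1_A w = fine (P A).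
Proof. by move=> mA; rewrite /Rintegral integral_indic// setIT. Qed.

Lemma le_RintegralT f g : bounded_rv f -> bounded_rv g ->
  (forall w, f w <= g w) -> \int[P]_w f w <= \int[P]_w g w.
Proof. by move=> bf bg fg; apply: le_Rintegral => //; exact: bounded_rv_integrable. Qed.

(** The indicator keeps the factor P(A), so that errors on the disjoint pieces of an event add up to
    a multiple of its probability. *)
Lemma RintegralT_dist (A : set T) c f g : measurable A -> bounded_rv f -> bounded_rv g ->
  (forall w, `|f w - g w| <= c * \1_A w) ->
  `|\int[P]_w f w - \int[P]_w g w| <= c * fine (P A).
Proof.
move=> mA bf bg fg; rewrite -RintegralT_indic//.
have bA := bounded_rv_indic mA.
have bcA := bounded_rvM (bounded_rv_cst c) bA.
have h := fun w => fg w; move: h.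
rewrite -RintegralT_Zl// ler_distl => h; apply/andP; split.
  rewrite lerBlDr -RintegralT_D//; apply: le_RintegralT => //; first exact: bounded_rvD.
  by move=> w; have := h w; rewrite ler_distl; lra.
rewrite -RintegralT_D//; apply: le_RintegralT => //; first exact: bounded_rvD.
by move=> w; have := h w; rewrite ler_distl; lra.
Qed.

Definition cdf_of (g : T -> R) (y : R) : R := fine (P [set w | g w <= y]).

Lemma measurable_ray (g : T -> R) y : measurable_fun setT g -> measurable [set w | g w <= y].
Proof.
move=> mg; rewrite -[X in measurable X]setTI.
have := mg measurableT `]-oo, y]%classic (measurable_itv _).
by congr (measurable (_ `&` _)); apply/seteqP; split=> w /=; rewrite in_itv.
Qed.

(** For each outcome w this is [integrates_pt] at g w; integrating over w turns the step functions
    into [cdf_of g]. *)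
Lemma integrates_rv (D : R) (g : T -> R) : measurable_fun setT g ->
  (forall w, `|g w| <= D) ->
  integrates D (cdf_of g) (fun f => \int[P]_w f (g w)).
Proof.
move=> mg gD L f del N fL d0 DN.
pose A j := [set w | g w <= grid D del j].
have mA j : measurable (A j) by exact: measurable_ray.
pose c (j : 'I_N) w : R := f (grid D del j) * (\1_(A j.+1) w + (-1) * \1_(A j) w).
have bA j := bounded_rv_indic (mA j).
have b1 (j : 'I_N) : bounded_rv (fun w => \1_(A j.+1) w + (-1) * \1_(A j) w).
  by apply: bounded_rvD => //; apply: bounded_rvM => //; exact: bounded_rv_cst.
have bc j : bounded_rv (c j) by apply: bounded_rvM => //; exact: bounded_rv_cst.
have -> : grid_sum D del N (cdf_of g) f = \int[P]_w (\sum_(j < N) c j w).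
  rewrite RintegralT_sum//; apply: eq_bigr => j _.
  rewrite RintegralT_Zl// RintegralT_D//; last first.
    by apply: bounded_rvM => //; exact: bounded_rv_cst.
  by rewrite RintegralT_Zl// !RintegralT_indic// mulN1r.
have := @RintegralT_dist setT (L * del) (f \o g) (fun w => \sum_(j < N) c j w).
rewrite probability_setT/= mulr1; apply => //.
- exact: bounded_rv_lip fL mg gD.
- exact: bounded_rv_sum.
move=> w; rewrite indicT mulr1.
have := integrates_pt (gD w) fL d0 DN; congr (`| _ - _ | <= _).
have inA j : (w \in A j) = (g w <= grid D del j).
  by apply/idP/idP; rewrite inE.
by apply: eq_bigr => j _; rewrite /c mulN1r !indicE !inA.
Qed.

Lemma is_cdf_rv (D : R) (g : T -> R) : measurable_fun setT g ->
  (forall w, `|g w| <= D) -> is_cdf D (cdf_of g).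
Proof.
move=> mg gD; have gD' w : - D <= g w <= D by rewrite -ler_norml.
split=> [x y xy|y yD|y yD]; rewrite /cdf_of.
- apply: fine_le; try exact: (fin_num_measure P _ (measurable_ray _ mg)).
  have sub : [set w | g w <= x] `<=` [set w | g w <= y] by move=> w /= h; exact: le_trans h xy.
  by apply: (le_measure P) => //; rewrite inE; exact: measurable_ray.
- suff -> : [set w | g w <= y] = set0 by rewrite measure0.
  apply/seteqP; split=> // w /= gy; have /andP[h _] := gD' w.
  by move: (le_lt_trans gy yD); rewrite ltNge h.
- suff -> : [set w | g w <= y] = setT by rewrite probability_setT.
  apply/seteqP; split=> // w _ /=; have /andP[_ h] := gD' w.
  exact: le_trans h yD.
Qed.

End bounded_expectation.

(** * Distributional Bellman operator and its projected fixed points *)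

(** Rewards are bounded only almost surely. Truncating them makes the bounds hold at every outcome
    without changing the laws. *)
Definition clamp (R : realType) (M r : R) : R := Num.max (- M) (Num.min r M).

Lemma clamp_lip (R : realType) (M : R) : lip 1 (clamp M).
Proof.
move=> x y; rewrite mul1r /clamp.
have := ler_norm (x - y); have := ler_norm (y - x); rewrite (distrC y).
move: `|x - y| => a.
by case: (leP x M) => ?; case: (leP y M) => ?; case: (leP (- M) x) => ?;
  case: (leP (- M) y) => ?; case: (leP (- M) M) => ?; rewrite ler_norml; lra.
Qed.

Lemma clamp_bound (R : realType) (M r : R) : 0 <= M -> `|clamp M r| <= M.
Proof.
move=> M0; rewrite /clamp ler_norml le_max lexx/= ge_max ge_min lexx orbT andbT.
by lra.
Qed.

Lemma clamp_id (R : realType) (M r : R) : `|r| <= M -> clamp M r = r.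
Proof.
by rewrite ler_norml /clamp => /andP[? ?]; rewrite min_l// max_r.
Qed.

Lemma measure_full_eq d (T : measurableType d) (R : realType) (P : probability T R)
    (G A B : set T) : measurable G -> measurable A -> measurable B ->
  P G = 1%E -> A `&` G = B `&` G -> P A = P B.
Proof.
move=> mG mA mB PG AB; have PG0 : P (~` G) = 0%E.
  by rewrite probability_setC// PG subee.
have e C : measurable C -> P C = P (C `&` G).
  move=> mC; have -> : P C = (P (C `\` G) + P (C `&` G))%E by exact: measureDI.
  rewrite (_ : P (C `\` G) = 0%E) ?add0e//.
  apply: (@subset_measure0 _ _ _ P _ (~` G)) => //; [exact: measurableD|exact: measurableC].
by rewrite (e A)// AB -(e B).
Qed.

Lemma integral_bounded_rv d (T : measurableType d) (R : realType)
    (P : probability T R) (f : T -> R) : bounded_rv f ->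
  (\int[P]_w (f w)%:E = (\int[P]_w f w)%:E)%E.
Proof.
move=> bf; rewrite /Rintegral fineK//.
exact: (integrable_fin_num measurableT (bounded_rv_integrable P bf)).
Qed.

Lemma quantileE (R : realType) (mu : set R -> \bar R) (F : R -> R) (tau : R) :
  (forall y, mu `]-oo, y]%classic = (F y)%:E) -> quantile mu tau = cdf_quantile F tau.
Proof.
move=> h; rewrite /quantile /cdf_quantile; congr inf.
by apply/seteqP; split=> y /=; rewrite h lee_fin.
Qed.

Lemma uniform_diracE (R : realType) (K : nat) (q : 'I_K -> R) (B : set R) :
  (\sum_(i < K) (K%:R^-1)%:E * \d_(q i) B)%E =
  (\sum_(i < K) uniform_fdist R i * (q i \in B)%:R)%:E.
Proof. by rewrite -sumEFin; apply: eq_bigr => i _; rewrite diracE -EFinM. Qed.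

Lemma uniform_dirac_ray (R : realType) (K : nat) (q : 'I_K -> R) (y : R) :
  (\sum_(i < K) (K%:R^-1)%:E * \d_(q i) `]-oo, y]%classic)%E = (atomic_cdf q y)%:E.
Proof.
rewrite uniform_diracE; congr EFin; apply: eq_bigr => i _; congr (_ * _%:R).
by rewrite mem_setE in_itv.
Qed.

(** Evaluation at singletons counts multiplicities, so the atoms agree as multisets; equality of the
    measures says nothing about their order. *)
Lemma uniform_dirac_perm (R : realType) (K : nat) (q s : 'I_K -> R) :
  (0 < K)%N ->
  (forall B, measurable B -> (\sum_(i < K) (K%:R^-1)%:E * \d_(q i) B =
                              \sum_(i < K) (K%:R^-1)%:E * \d_(s i) B :> \bar R)%E) ->
  perm_eq (codom q) (codom s).
Proof.
move=> K0 h; apply/allP => v _; apply/eqP.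
have cE (u : 'I_K -> R) : (count_mem v (codom u))%:R = \sum_i (u i \in [set v])%:R :> R.
  rewrite codomE count_map -sum1_count big_enum_cond/= natr_sum big_mkcond/=.
  apply: eq_bigr => i _; have -> : (u i \in [set v]) = (u i == v).
    by apply/idP/idP => [|/eqP->]; rewrite inE// => ->.
  by case: (_ == _).
apply/eqP; rewrite -(eqr_nat R) !cE; apply/eqP.
have := h _ (measurable_set1 v); rewrite !uniform_diracE => -[].
rewrite /uniform_fdist -!mulr_sumr; apply: mulfI.
by rewrite invr_eq0 pnatr_eq0 -lt0n.
Qed.

Lemma sum_codom_perm (R : realType) (K : nat) (q s : 'I_K -> R) (f : R -> R) :
  perm_eq (codom q) (codom s) -> \sum_i f (q i) = \sum_i f (s i).
Proof.
have sE (u : 'I_K -> R) : \sum_i f (u i) = \sum_(x <- codom u) f x.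
  by rewrite codomE big_map big_enum.
by move=> qs; rewrite !sE (perm_big _ qs).
Qed.

Section qdrl_fixed_point.
Context (R : realType) (gamma Rmax : R) (K : nat).
Hypothesis hgamma : 0 <= gamma < 1.
Hypothesis hRmax : 0 < Rmax.
Hypothesis hK : (0 < K)%N.
Context (X A : finType) (p : X -> A -> X -> R) (pi : X -> A -> R).
Context (Rdist : X -> A -> probability R R).
Hypothesis hp : forall x a, is_fdist (p x a).
Hypothesis hpi : forall x, is_fdist (pi x).
Hypothesis hR : forall x a, Rdist x a [set r | `|r| <= Rmax] = 1%E.
Context (z : X -> A -> 'I_K -> R).

Let backup x' a' i (r : R) : R := clamp Rmax r + gamma * z x' a' i.

(** Distribution function of T eta as nested finite mixtures, so that the mixture lemmas apply level
    by level. [bellman] is only a set function; [bellman_ray] links the two. *)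
Definition bellman_cdf x a (y : R) : R :=
  \sum_x' p x a x' * \sum_a' pi x' a' *
    \sum_i uniform_fdist R i * cdf_of (Rdist x a) (backup x' a' i) y.

Definition bellman_int x a (f : R -> R) : R :=
  \sum_x' p x a x' * \sum_a' pi x' a' *
    \sum_i uniform_fdist R i * \int[Rdist x a]_r f (backup x' a' i r).

Let measurable_backup x' a' i : measurable_fun setT (backup x' a' i).
Proof.
by apply: measurable_funD => //; exact: lip_measurable (@clamp_lip R Rmax).
Qed.

Let backup_bound M : (forall x a i, `|z x a i| <= M) ->
  forall x a i r, `|backup x a i r| <= Rmax + gamma * M.
Proof.
move=> zM x a i r; have /andP[g0 _] := hgamma.
rewrite (le_trans (ler_normD _ _))// lerD ?clamp_bound ?(ltW hRmax)//.
by rewrite normrM ger0_norm// ler_wpM2l.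
Qed.

Lemma is_cdf_bellman M : (forall x a i, `|z x a i| <= M) ->
  forall x a, is_cdf (Rmax + gamma * M) (bellman_cdf x a).
Proof.
move=> zM x a; apply: (is_cdf_mix (hp x a)) => x'.
apply: (is_cdf_mix (hpi x')) => a'; apply: (is_cdf_mix (is_fdist_uniform R hK)) => i.
apply: is_cdf_rv; first exact: measurable_backup.
exact: backup_bound zM _ _ _.
Qed.

Lemma integrates_bellman M : (forall x a i, `|z x a i| <= M) ->
  forall x a, integrates (Rmax + gamma * M) (bellman_cdf x a) (bellman_int x a).
Proof.
move=> zM x a; apply: (integrates_mix (hp x a)) => x'.
apply: (integrates_mix (hpi x')) => a'.
apply: (integrates_mix (is_fdist_uniform R hK)) => i.
apply: integrates_rv; first exact: measurable_backup.
exact: backup_bound zM _ _ _.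
Qed.

(** On a ray the inner integrand is a finite sum of indicators in r, and truncating r changes these
    sets by null sets only. *)
Lemma bellman_ray x a y :
  bellman p pi Rdist gamma (qdist z) x a `]-oo, y]%classic = (bellman_cdf x a y)%:E.
Proof.
rewrite /bellman /bellman_cdf -sumEFin; apply: eq_bigr => x' _.
rewrite mulr_sumr -sumEFin; apply: eq_bigr => a' _.
rewrite mulrA [RHS]EFinM; congr (_ * _)%E.
pose S i := [set r | r + gamma * z x' a' i <= y].
have mS i : measurable (S i).
  by apply: measurable_ray; apply: measurable_funD => //; exact: measurable_id.
have bS i := bounded_rv_indic R (mS i).
under eq_integral => r _.
  rewrite /qdist uniform_diracE.
  under eq_bigr => i _.
    have -> : (z x' a' i \in (fun u => r + gamma * u) @^-1` `]-oo, y]%classic) = (r \in S i).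
      by apply/idP/idP; rewrite !inE /S/= ?in_itv.
    rewrite -[(_ \in S i)%:R]indicE.
    over.
  over.
have bcS i : bounded_rv (fun r => uniform_fdist R i * \1_(S i) r).
  by apply: bounded_rvM => //; exact: bounded_rv_cst.
rewrite integral_bounded_rv; last exact: bounded_rv_sum.
rewrite RintegralT_sum//; congr EFin; apply: eq_bigr => i _.
rewrite RintegralT_Zl// RintegralT_indic//; congr (_ * fine _).
apply: (measure_full_eq _ _ _ (hR x a)) => //.
- by apply: (measurable_ray Rmax); exact: normr_measurable.
- by apply: measurable_ray; exact: measurable_backup.
by apply/seteqP; split=> r /= [h hr]; split=> //; move: h; rewrite /S /backup/= clamp_id.
Qed.

Hypothesis hfix : forall x a (B : set R), measurable B ->
  qdist z x a B = proj_W1 K (bellman p pi Rdist gamma (qdist z) x a) B.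

Let q x a (i : 'I_K) : R := cdf_quantile (bellman_cdf x a) (tau_lvl R i).

Lemma proj_W1_bellman x a (B : set R) :
  proj_W1 K (bellman p pi Rdist gamma (qdist z) x a) B =
  (\sum_(i < K) (K%:R^-1)%:E * \d_(q x a i) B)%E.
Proof.
by apply: eq_bigr => i _; rewrite (quantileE (tau_lvl R i) (bellman_ray x a)).
Qed.

Lemma fixpoint_perm x a : perm_eq (codom (z x a)) (codom (q x a)).
Proof.
by apply: uniform_dirac_perm => // B mB; rewrite -proj_W1_bellman -hfix.
Qed.

(** Let M be the largest absolute value of an atom. The atom attaining it is a quantile of T eta,
    which lives within Rmax + gamma M of 0, so M <= Rmax + gamma M. *)
Lemma fixpoint_bound x a i : `|z x a i| <= Rmax / (1 - gamma).
Proof.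
have /andP[g0 g1] := hgamma.
pose zabs (t : X * A * 'I_K) := `|z t.1.1 t.1.2 t.2|.
have [[[x0 a0] i0] _ tmax] := @arg_maxP _ _ _ (x, a, i) xpredT zabs isT.
set M := zabs (x0, a0, i0) in tmax.
have zM x' a' i' : `|z x' a' i'| <= M by exact: (tmax (x', a', i') isT).
have : z x0 a0 i0 \in codom (q x0 a0) by rewrite -(perm_mem (fixpoint_perm x0 a0)) codom_f.
case/codomP => j zj.
have : M <= Rmax + gamma * M.
  rewrite {1}/M /zabs/= zj; apply: (cdf_quantile_bound (is_cdf_bellman zM x0 a0)).
  by rewrite tau_lvl_gt0//= ltW// tau_lvl_lt1.
move=> hM; rewrite (le_trans (zM x a i))// ler_pdivlMr; last by lra.
by lra.
Qed.

Let D := Rmax / (1 - gamma).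

Let D_eq : Rmax + gamma * D = D.
Proof.
have /andP[g0 g1] := hgamma; rewrite /D; field; rewrite subr_eq0 gt_eqF//.
Qed.

Lemma is_cdf_bellman_fixpoint x a : is_cdf D (bellman_cdf x a).
Proof. by rewrite -D_eq; exact: is_cdf_bellman fixpoint_bound x a. Qed.

(** The q are sorted in their index, so as atoms of eta they are its midpoint quantiles, whatever
    the order of z. *)
Lemma quantile_fixpoint x a (i : 'I_K) :
  quantile (qdist z x a) (tau_lvl R i) = cdf_quantile (bellman_cdf x a) (tau_lvl R i).
Proof.
rewrite (@quantileE _ _ (atomic_cdf (q x a))) => [|y].
  rewrite cdf_quantile_atomic// => j k jk.
  exact: quantile_proj_mono (is_cdf_bellman_fixpoint x a) _ _ jk.
by rewrite hfix// proj_W1_bellman uniform_dirac_ray.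
Qed.

Lemma quantile_fixpoint_sum x a (f : R -> R) :
  \sum_(i < K) f (quantile (qdist z x a) (tau_lvl R i)) = \sum_i f (z x a i).
Proof.
under eq_bigr do rewrite quantile_fixpoint.
by rewrite (sum_codom_perm f (fixpoint_perm x a)).
Qed.

Lemma quantile_fixpoint_mono x a (i j : 'I_K) : (i <= j)%N ->
  quantile (qdist z x a) (tau_lvl R i) <= quantile (qdist z x a) (tau_lvl R j).
Proof.
move=> ij; rewrite !quantile_fixpoint.
exact: quantile_proj_mono (is_cdf_bellman_fixpoint x a) _ _ ij.
Qed.

Definition qdist_int x a (f : R -> R) : R := \sum_i uniform_fdist R i * f (z x a i).

(** As a multiset the atoms of eta are the midpoint quantiles of T eta, so the projection estimate
    bounds the residual of the fixed point. *)
Lemma bellman_error x a L f : lip L f ->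
  `|bellman_int x a f - qdist_int x a f| <= L * (D / K%:R).
Proof.
move=> fL; have FI := integrates_bellman fixpoint_bound x a; rewrite -/D D_eq in FI.
have := quantile_proj_error hK (is_cdf_bellman_fixpoint x a) FI fL.
rewrite /qdist_int; congr (`|_ - _| <= _).
rewrite -!mulr_sumr; congr (_ * _).
by rewrite (sum_codom_perm f (fixpoint_perm x a)).
Qed.

End qdrl_fixed_point.

(** * Discounted sums and measurability of limits *)

Section discounted_sum.
Context (R : realType) (gamma M : R).
Hypothesis hgamma : 0 <= gamma < 1.

Definition disc_partial (y : nat -> R) (n : nat) : R := \sum_(t < n) gamma ^+ t * y t.

Definition disc_sum (y : nat -> R) : R := limn (disc_partial y).

Lemma disc_partialS y n :
  disc_partial y n.+1 = y 0%N + gamma * disc_partial (fun t => y t.+1) n.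
Proof.
rewrite /disc_partial big_ord_recl expr0 mul1r mulr_sumr; congr (_ + _).
by apply: eq_bigr => i _; rewrite /= /bump add1n exprS mulrA.
Qed.

Lemma disc_partial_bound y n : (forall t, `|y t| <= M) ->
  `|disc_partial y n| <= M / (1 - gamma).
Proof.
have /andP[g0 g1] := hgamma.
elim: n y => [|n IH] y yM.
  rewrite /disc_partial big_ord0 normr0 divr_ge0//; last by lra.
  exact: le_trans (yM 0%N).
rewrite disc_partialS (le_trans (ler_normD _ _))//.
have -> : M / (1 - gamma) = M + gamma * (M / (1 - gamma)).
  by field; rewrite subr_eq0 gt_eqF.
by rewrite lerD// normrM ger0_norm// ler_wpM2l// IH.
Qed.

Lemma disc_partial_cvg y : (forall t, `|y t| <= M) -> cvgn (disc_partial y).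
Proof.
move=> yM; have /andP[g0 g1] := hgamma.
have -> : disc_partial y = series (fun t => gamma ^+ t * y t) by rewrite seriesEord.
apply: normed_cvg; apply: (@series_le_cvg _ _ (geometric M gamma)).
- by move=> n; exact: normr_ge0.
- by move=> n; rewrite /= mulr_ge0 ?exprn_ge0// (le_trans _ (yM 0%N)).
- by move=> n /=; rewrite normrM ger0_norm ?exprn_ge0// mulrC ler_wpM2r ?exprn_ge0.
by apply: is_cvg_geometric_series; rewrite ger0_norm.
Qed.

Lemma disc_sumS y : (forall t, `|y t| <= M) ->
  disc_sum y = y 0%N + gamma * disc_sum (fun t => y t.+1).
Proof.
move=> yM; apply: cvg_lim => //; rewrite -cvg_shiftS.
under eq_fun do rewrite disc_partialS.
apply: cvgD; first exact: cvg_cst.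
by apply: cvgMr; apply: disc_partial_cvg.
Qed.

Lemma disc_sum_bound y : (forall t, `|y t| <= M) -> `|disc_sum y| <= M / (1 - gamma).
Proof.
move=> yM; have c := disc_partial_cvg yM.
have b n : - (M / (1 - gamma)) <= disc_partial y n <= M / (1 - gamma).
  by rewrite -ler_norml disc_partial_bound.
rewrite ler_norml; apply/andP; split.
  by apply: limr_ge => //; apply: nearW => n; have /andP[] := b n.
by apply: limr_le => //; apply: nearW => n; have /andP[] := b n.
Qed.

End discounted_sum.

Section measurable_limit.
Context d (T : measurableType d) (R : realType) (u : nat -> T -> R).
Hypothesis mu_ : forall n, measurable_fun setT (u n).

(** All quantifiers are countable, so the set of convergence becomes a countable combination of
    measurable sets. *)
Lemma cvgn_cauchy (v : nat -> R) : cvgn v <->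
  forall k, exists n, forall m, (n <= m)%N -> `|v m - v n| <= k.+1%:R^-1.
Proof.
split=> [cv k|h].
  have e0 : 0 < (2 * k.+1%:R)^-1 :> R by rewrite invr_gt0 mulr_gt0.
  have [n _ hn] := (cvgrPdist_le (F:=\oo) v (limn v)).1 cv _ e0.
  exists n => m nm; have := hn m nm; have := hn n (leqnn n).
  have -> : k.+1%:R^-1 = (2 * k.+1%:R)^-1 + (2 * k.+1%:R)^-1 :> R by field.
  move: (limn v) (2 * _)^-1 => /= l e hn1 hn2.
  by rewrite (le_trans (ler_distD l _ _))// lerD// distrC.
apply/cauchy_cvgP/cauchy_exP => e e0.
have [k ke] : exists k : nat, k.+1%:R^-1 < e.
  exists (Num.truncn e^-1); rewrite invf_plt ?posrE//.
  by have /andP[] := truncn_itv (ltW (eq_ind_r is_true e0 (invr_gt0 e))).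
have [n hn] := h k; exists (v n); exists n => // m /= nm.
by rewrite /ball/= distrC (le_lt_trans (hn m nm)).
Qed.

Lemma measurable_cvgn : measurable [set w | cvgn (u ^~ w)].
Proof.
have -> : [set w | cvgn (u ^~ w)] = \bigcap_k \bigcup_n \bigcap_m
    [set w | `|u (n + m)%N w - u n w| <= k.+1%:R^-1].
  apply/seteqP; split=> w /=.
    move=> /cvgn_cauchy h k _; have [n hn] := h k; exists n => // m _ /=.
    by apply: hn; rewrite leq_addr.
  move=> h; apply/cvgn_cauchy => k; have [n _ hn] := h k I; exists n => m nm.
  by have := hn (m - n)%N I; rewrite /= subnKC.
apply: bigcapT_measurable => k; apply: bigcupT_measurable => n.
apply: bigcapT_measurable => m; apply: measurable_ray.
by apply: measurableT_comp => //; exact: measurable_funB.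
Qed.

(* Off the set of convergence [limn] is the junk constant [point]. *)
Lemma measurable_limn : measurable_fun setT (fun w => limn (u ^~ w)).
Proof.
pose C := [set w | cvgn (u ^~ w)].
have mC : measurable C by exact: measurable_cvgn.
rewrite -(setUv C); apply/measurable_funU => //; first exact: measurableC.
split.
  apply: measurable_fun_cvg => [m|w h]; last exact: h.
  exact: measurable_funS (mu_ m).
apply: (eq_measurable_fun (fun=> point)); last exact: measurable_cst.
by move=> w; rewrite inE => h; rewrite dvgP.
Qed.

End measurable_limit.

(** * Law of the return *)

Section mdp_return.
Context (R : realType) (gamma Rmax : R) (K : nat).
Hypothesis hgamma : 0 <= gamma < 1.
Hypothesis hRmax : 0 < Rmax.
Hypothesis hK : (0 < K)%N.
Context (X A : finType) (p : X -> A -> X -> R) (pi : X -> A -> R).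
Context (Rdist : X -> A -> probability R R).
Hypothesis hp : forall x a, is_fdist (p x a).
Hypothesis hpi : forall x, is_fdist (pi x).
Hypothesis hR : forall x a, Rdist x a [set r | `|r| <= Rmax] = 1%E.
Context (z : X -> A -> 'I_K -> R).
Let D := Rmax / (1 - gamma).
Hypothesis zD : forall x a i, `|z x a i| <= D.
Context (err : R).
Hypothesis err0 : 0 <= err.
Hypothesis herr : forall x a L f, lip L f ->
  `|bellman_int gamma Rmax p pi Rdist z x a f - qdist_int z x a f| <= L * err.
Context (x0 : X) (a0 : A) d (T : measurableType d) (P : probability T R).
Context (Xs : nat -> T -> X) (As : nat -> T -> A) (Rs : nat -> T -> R).
Hypothesis hproc : mdp_process p pi Rdist x0 a0 P Xs As Rs.

Definition clamped_return n w : R := disc_sum gamma (fun t => clamp Rmax (Rs (n + t)%N w)).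

Local Notation Z := clamped_return.

Let clampM r : `|clamp Rmax r| <= Rmax.
Proof. exact: clamp_bound (ltW hRmax). Qed.

Let measurable_clamped t : measurable_fun setT (fun w => clamp Rmax (Rs t w)).
Proof.
have [_ [_ [mR _]]] := hproc.
exact: measurableT_comp (lip_measurable (@clamp_lip R Rmax)) (mR t).
Qed.

Lemma measurable_clamped_return n : measurable_fun setT (Z n).
Proof.
apply: measurable_limn => m; rewrite /disc_partial.
by apply: measurable_sum => i; apply: measurable_funM => //; exact: measurable_cst.
Qed.

Lemma clamped_return_bound n w : `|Z n w| <= D.
Proof. exact: disc_sum_bound. Qed.

Lemma clamped_returnS n w : Z n w = clamp Rmax (Rs n w) + gamma * Z n.+1 w.
Proof.
rewrite /Z (disc_sumS hgamma (M := Rmax))// addn0; congr (_ + _ * disc_sum _ _).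
by apply/funext => t; rewrite addnS addSn.
Qed.

(** * Events that fix a finite history, and their probabilities *)

Definition prefix n (xs : nat -> X) (acts : nat -> A) (Bs : nat -> set R) : set T :=
  [set w | forall t, (t <= n)%N ->
     [/\ Xs t w = xs t, As t w = acts t & Bs t (Rs t w)]].

Lemma measurable_prefix n xs acts Bs :
  (forall t, measurable (Bs t)) -> measurable (prefix n xs acts Bs).
Proof.
move=> mB; have [mX [mA [mR _]]] := hproc.
have -> : prefix n xs acts Bs = \bigcap_(t in [set t | (t <= n)%N])
    ([set w | Xs t w = xs t] `&` [set w | As t w = acts t] `&` (Rs t @^-1` Bs t)).
  apply/seteqP; split=> w h t tn; have := h t tn; first by case.
  by case=> -[].
apply: bigcap_measurableType => t _; apply: measurableI; first exact: measurableI.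
by rewrite -[X in measurable X]setTI; exact: mR.
Qed.

Let rr x a (B : set R) : R := fine (Rdist x a B).

Lemma prefix_prob n xs acts Bs : (forall t, measurable (Bs t)) ->
  fine (P (prefix n xs acts Bs)) =
  ((xs 0%N == x0) && (acts 0%N == a0))%:R * (\prod_(t < n.+1) rr (xs t) (acts t) (Bs t))
  * (\prod_(t < n) (p (xs t) (acts t) (xs t.+1) * pi (xs t.+1) (acts t.+1))).
Proof.
move=> mB; have [_ [_ [_ ->]]] := hproc => //.
rewrite (eq_bigr (fun t : 'I_n.+1 => (rr (xs t) (acts t) (Bs t))%:E)) => [|t _]; last first.
  by rewrite fineK// fin_num_measure.
by rewrite !prodEFin.
Qed.

Lemma prefix_prob_ge0 n xs acts Bs : 0 <= fine (P (prefix n xs acts Bs)).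
Proof. exact: fine_ge0. Qed.

(** Split over the finitely many state-action histories up to t: each event has a vanishing factor,
    the mass that a reward distribution gives to values beyond Rmax. *)
Lemma reward_bounded_ae t : P.-negligible [set w | ~ `|Rs t w| <= Rmax].
Proof.
pose xs (o : {ffun 'I_t.+1 -> X * A}) s := (o (inord s)).1.
pose acts (o : {ffun 'I_t.+1 -> X * A}) s := (o (inord s)).2.
pose big : set R := [set r | ~ `|r| <= Rmax].
have mbig : measurable big.
  by apply: measurableC; apply: (measurable_ray Rmax); exact: normr_measurable.
pose Bs s : set R := if s == t then big else setT.
have mB s : measurable (Bs s) by rewrite /Bs; case: eqP => // _; exact: measurableT.
(* Enumerating histories by their [pickle] codes makes the union countable; a number that codes no
   history contributes the empty set. *)
pose F k := if unpickle k is Some o then prefix t (xs o) (acts o) Bs else set0.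
apply: (@negligibleS _ _ _ _ (\bigcup_k F k)).
  move=> w /= hw; pose o := [ffun s : 'I_t.+1 => (Xs s w, As s w)].
  exists (pickle o) => //; rewrite /F pickleK => s st.
  rewrite /xs /acts /o ffunE/= inordK ?ltnS//; split=> //.
  by rewrite /Bs; case: eqP => [->|].
apply: negligible_bigcup => k; rewrite /F; case: unpickle => [om|]; last exact: negligible_set0.
apply/negligibleP; first exact: measurable_prefix.
have : fine (P (prefix t (xs om) (acts om) Bs)) = 0.
  rewrite prefix_prob// big_ord_recr/= /Bs eqxx.
  suff -> : rr (xs om t) (acts om t) big = 0 by rewrite mulr0 mulr0 mul0r.
  rewrite /rr (_ : big = ~` [set r | `|r| <= Rmax])// probability_setC ?hR ?subee//.
  by apply: (measurable_ray Rmax); exact: normr_measurable.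
move=> h; rewrite -[LHS]fineK ?h// fin_num_measure//; exact: measurable_prefix.
Qed.

(** All rewards are bounded simultaneously on an event of probability one, where truncation is the
    identity. *)
Lemma return_law_ray y :
  return_law P gamma Rs `]-oo, y]%classic = (cdf_of P (Z 0) y)%:E.
Proof.
have [_ [_ [mR _]]] := hproc.
have mG t : measurable [set w | `|Rs t w| <= Rmax].
  by apply: measurable_ray; apply: measurableT_comp => //; exact: mR.
pose G := \bigcap_t [set w | `|Rs t w| <= Rmax].
have mGG : measurable G by exact: bigcapT_measurable.
have mret : measurable_fun setT (disc_return gamma Rs).
  apply: measurable_limn => n; apply: measurable_sum => i.
  by apply: measurable_funM => //.
have mZ := measurable_clamped_return 0.
have ray (g : T -> R) : g @^-1` `]-oo, y]%classic = [set w | g w <= y].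
  by apply/seteqP; split=> w /=; rewrite in_itv.
rewrite /return_law /cdf_of ray fineK; last first.
  by apply: fin_num_measure; exact: measurable_ray.
apply: (@measure_full_eq _ _ _ _ G) => //; try exact: measurable_ray.
  have nG : P.-negligible (~` G).
    rewrite /G setC_bigcap; apply: negligible_bigcup => t.
    exact: reward_bounded_ae.
  have : P (~` G) = 0%E by apply: measure_negligible => //; exact: measurableC.
  rewrite probability_setC// => h.
  have PG : P G \is a fin_num by exact: fin_num_measure.
  by move: h; rewrite -(fineK PG) -EFinB => -[] /eqP; rewrite subr_eq0 => /eqP <-.
apply/seteqP; split=> w /= [h Gw]; split=> //; move: h;
  suff -> : disc_return gamma Rs w = Z 0 w by [];
  rewrite /disc_return /Z /disc_sum /disc_partial; congr (limn _);
  apply/funext => n; apply: eq_bigr => t _; rewrite clamp_id// ; exact: (Gw t I).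
Qed.

(** * One transition of the process, with the reward discretised *)

Section one_step.
Context (del : R) (N : nat).
Hypothesis d0 : 0 < del.
Hypothesis DN : Rmax <= grid Rmax del N.

Let b j : R := grid Rmax del j.
Definition cell j : set R := [set r | b j < clamp Rmax r <= b j.+1].

Lemma cellE j : cell j = [set r | clamp Rmax r <= b j.+1] `\` [set r | clamp Rmax r <= b j].
Proof.
apply/seteqP; split=> r /=; first by move=> /andP[h1 h2]; split=> //; apply/negP; rewrite -ltNge.
by rewrite /cell/= => -[-> /negP]; rewrite -ltNge => ->.
Qed.

Let measurable_cray j : measurable [set r | clamp Rmax r <= b j].
Proof. by apply: measurable_ray; exact: lip_measurable (@clamp_lip R Rmax). Qed.

Lemma measurable_cell j : measurable (cell j).
Proof. by rewrite cellE; exact: measurableD. Qed.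

Lemma cell_prob x a j :
  rr x a (cell j) = cdf_of (Rdist x a) (clamp Rmax) (b j.+1) - cdf_of (Rdist x a) (clamp Rmax) (b j).
Proof.
rewrite /rr cellE measureD//; last by rewrite -ge0_fin_numE// fin_num_measure.
rewrite setIidr; first by rewrite fineB// fin_num_measure.
by move=> r /= h; rewrite (le_trans h)// -subr_ge0 grid_step ltW.
Qed.

Lemma cell_partition r : \sum_(j < N) (r \in cell j)%:R = 1 :> R.
Proof.
pose c (j : nat) : R := (clamp Rmax r <= b j)%R%:R.
have /andP[r1 r2] : - Rmax <= clamp Rmax r <= Rmax by rewrite -ler_norml.
rewrite (eq_bigr (fun j : 'I_N => c j.+1 - c j)) => [|j _].
  rewrite -(big_mkord xpredT (fun j => c j.+1 - c j)) telescope_sumr// /c.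
  rewrite (le_trans r2 DN) [_ <= b 0]leNgt.
  suff -> : b 0%N < clamp Rmax r by rewrite subr0.
  apply: lt_le_trans r1; rewrite /b /grid mul0r; move: d0; lra.
rewrite /c; have -> : (r \in cell j) = (b j < clamp Rmax r <= b j.+1).
  by apply/idP/idP; rewrite inE.
have s : b j.+1 - b j = del by exact: grid_step.
have [h|h] := leP (clamp Rmax r) (b j); last by rewrite subr0.
by rewrite (le_trans h) ?subrr// -subr_ge0 s ltW.
Qed.

Definition upd (V : Type) (f : nat -> V) (k : nat) (v : V) : nat -> V :=
  fun t => if t == k then v else f t.

(** The reward at time n + 1 is left free, which re-establishes [Bs n = setT] one step later: the
    children form a tree of events along which induction can run. *)
Let next n xs acts Bs (t : X * A * 'I_N) : set T :=
  prefix n.+1 (upd xs n.+1 t.1.1) (upd acts n.+1 t.1.2)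
    (upd (upd Bs n (cell t.2)) n.+1 setT).

Lemma next_measurable_sets n (Bs : nat -> set R) (j : 'I_N) :
  (forall t, measurable (Bs t)) ->
  forall t, measurable (upd (upd Bs n (cell j)) n.+1 setT t).
Proof.
move=> mB t; rewrite /upd; case: eqP => _; first exact: measurableT.
by case: eqP => _; [exact: measurable_cell|exact: mB].
Qed.

Lemma mem_next n xs acts Bs t w : Bs n = setT ->
  (w \in next n xs acts Bs t) = [&& w \in prefix n xs acts Bs,
    Xs n.+1 w == t.1.1, As n.+1 w == t.1.2 & Rs n w \in cell t.2].
Proof.
move=> BnT; apply/idP/and4P; rewrite !inE.
  move=> h; have [hX hA _] := h n.+1 (leqnn _); rewrite /upd eqxx in hX hA.
  have [_ _ hR'] := h n (leqnSn _).
  rewrite /upd (ltn_eqF (ltnSn n)) eqxx in hR'.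
  split; [|exact/eqP|exact/eqP|exact: hR'] => s sn.
  have [h1 h2 h3] := h s (leqW sn).
  have e : (s == n.+1) = false by rewrite ltn_eqF.
  rewrite /upd e in h1 h2 h3.
  by split=> //; move: h3; case: eqP => [->|//]; rewrite BnT.
move=> [h /eqP hX /eqP hA hc] s; rewrite leq_eqVlt => /predU1P[->|sn].
  by rewrite /upd eqxx; split.
have e : (s == n.+1) = false by rewrite ltn_eqF.
have [h1 h2 h3] := h s sn; rewrite /upd e; split=> //.
by case: eqP => [->|].
Qed.

Lemma indic_next n xs acts Bs w : Bs n = setT ->
  \sum_t \1_(next n xs acts Bs t) w = \1_(prefix n xs acts Bs) w :> R.
Proof.
move=> BnT; pose F x' a' (j : 'I_N) : R := \1_(prefix n xs acts Bs) w *
  ((x' == Xs n.+1 w)%:R * ((a' == As n.+1 w)%:R * (Rs n w \in cell j)%:R)).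
rewrite (eq_bigr (fun t => F t.1.1 t.1.2 t.2)) => [|t _]; last first.
  rewrite indicE mem_next// /F indicE -!natrM !mulnb.
  by rewrite (eq_sym t.1.1) (eq_sym t.1.2).
rewrite -(pair_bigA _ (fun t j => F t.1 t.2 j))/=.
rewrite -(pair_bigA _ (fun x' a' => \sum_j F x' a' j))/= /F.
under eq_bigr do under eq_bigr do rewrite -!mulr_sumr cell_partition mulr1.
under eq_bigr do rewrite -!mulr_sumr.
have one (I : finType) (i : I) : \sum_i' (i' == i)%:R = 1 :> R.
  by rewrite (bigD1 i)//= eqxx big1 ?addr0// => i' /negbTE ->.
by under eq_bigr do rewrite one mulr1; rewrite -mulr_sumr one mulr1.
Qed.

(** This is the Markov property as the finite-dimensional laws express it: the free reward factor
    becomes the mass of a cell, and one transition factor is appended. *)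
Lemma next_prob n xs acts Bs t : (forall t, measurable (Bs t)) -> Bs n = setT ->
  fine (P (next n xs acts Bs t)) = fine (P (prefix n xs acts Bs)) *
    (rr (xs n) (acts n) (cell t.2) * (p (xs n) (acts n) t.1.1 * pi t.1.1 t.1.2)).
Proof.
move=> mB BnT; rewrite !prefix_prob//; last exact: next_measurable_sets.
have rT x a : rr x a setT = 1 by rewrite /rr probability_setT.
have ltS (i : 'I_n) : ((i == n :> nat) = false) * ((i == n.+1 :> nat) = false).
  by rewrite !ltn_eqF// ltnS ltnW.
rewrite !big_ord_recr/=.
have -> : \prod_(i < n) rr (upd xs n.+1 t.1.1 i) (upd acts n.+1 t.1.2 i)
    (upd (upd Bs n (cell t.2)) n.+1 setT i) = \prod_(i < n) rr (xs i) (acts i) (Bs i).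
  by apply: eq_bigr => i _; rewrite /upd !ltS.
have -> : \prod_(i < n) (p (upd xs n.+1 t.1.1 i) (upd acts n.+1 t.1.2 i)
      (upd xs n.+1 t.1.1 i.+1) * pi (upd xs n.+1 t.1.1 i.+1) (upd acts n.+1 t.1.2 i.+1)) =
    \prod_(i < n) (p (xs i) (acts i) (xs i.+1) * pi (xs i.+1) (acts i.+1)).
  by apply: eq_bigr => i _; rewrite /upd eqSS !ltS.
by rewrite /upd !eqxx (ltn_eqF (ltnSn n)) BnT !rT/=; ring.
Qed.

Let sumP n xs acts Bs : (forall t, measurable (Bs t)) -> Bs n = setT ->
  \sum_t fine (P (next n xs acts Bs t)) = fine (P (prefix n xs acts Bs)).
Proof.
move=> mB BnT; rewrite -(RintegralT_indic P (measurable_prefix n xs acts mB)).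
under [RHS]eq_Rintegral do rewrite -indic_next//.
rewrite RintegralT_sum => [|t]; last first.
  by apply: bounded_rv_indic; apply: measurable_prefix; exact: next_measurable_sets.
apply: eq_bigr => t _; rewrite RintegralT_indic//.
by apply: measurable_prefix; exact: next_measurable_sets.
Qed.

(* Conditionally on a prefix ending in [(x, a)], one step of the process
   followed by an atom of [z] has law [bellman], up to the grid error. *)
Lemma next_step n xs acts Bs L g : (forall t, measurable (Bs t)) -> Bs n = setT ->
  lip L g ->
  `|\sum_t fine (P (next n xs acts Bs t)) *
      qdist_int z t.1.1 t.1.2 (fun y => g (b t.2 + gamma * y))
    - fine (P (prefix n xs acts Bs)) * bellman_int gamma Rmax p pi Rdist z (xs n) (acts n) g|
  <= fine (P (prefix n xs acts Bs)) * (L * del).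
Proof.
move=> mB BnT gL; set x := xs n; set a := acts n.
pose G x' a' i : R := \sum_(j < N) g (b j + gamma * z x' a' i) * rr x a (cell j).
have -> : \sum_t fine (P (next n xs acts Bs t)) *
      qdist_int z t.1.1 t.1.2 (fun y => g (b t.2 + gamma * y)) =
    fine (P (prefix n xs acts Bs)) * (\sum_x' p x a x' * \sum_a' pi x' a' *
       \sum_i uniform_fdist R i * G x' a' i).
  pose H x' a' (j : 'I_N) := fine (P (prefix n xs acts Bs)) *
    (rr x a (cell j) * (p x a x' * pi x' a')) *
     qdist_int z x' a' (fun y => g (b j + gamma * y)).
  rewrite (eq_bigr (fun t => H t.1.1 t.1.2 t.2)) => [|t _]; last by rewrite next_prob.
  rewrite -(pair_bigA _ (fun t j => H t.1 t.2 j))/=.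
  rewrite -(pair_bigA _ (fun x' a' => \sum_j H x' a' j))/= /H.
  rewrite mulr_sumr; apply: eq_bigr => x' _.
  rewrite !mulr_sumr; apply: eq_bigr => a' _.
  rewrite !mulr_sumr /qdist_int /G; under eq_bigr do rewrite mulr_sumr.
  rewrite exchange_big/=; apply: eq_bigr => i _; rewrite !mulr_sumr.
  by apply: eq_bigr => j _; ring.
rewrite -mulrBr normrM ger0_norm ?prefix_prob_ge0// ler_wpM2l ?prefix_prob_ge0//.
rewrite /bellman_int -sumrB.
have mix (I : finType) (w F F' : I -> R) e : is_fdist w ->
    (forall i, `|F i - F' i| <= e) -> `|\sum_i (w i * F i - w i * F' i)| <= e.
  move=> [w0 w1] h; rewrite -[e]mul1r -w1 mulr_suml (le_trans (ler_norm_sum _ _ _))//.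
  by apply: ler_sum => i _; rewrite -mulrBr normrM ger0_norm// ler_wpM2l.
apply: (mix _ _ _ _ _ (hp x a)) => x'; rewrite -sumrB.
apply: (mix _ _ _ _ _ (hpi x')) => a'; rewrite -sumrB.
apply: (mix _ _ _ _ _ (is_fdist_uniform R hK)) => i.
have gL' : lip L (fun r => g (r + gamma * z x' a' i)).
  by move=> r r'; apply: le_trans (gL _ _) _; have -> : r + gamma * z x' a' i - (r' + gamma * z x' a' i) = r - r' by ring.
have := integrates_rv (Rdist x a) (lip_measurable (@clamp_lip R Rmax)) clampM gL' d0 DN.
rewrite distrC; congr (`|_ - _| <= _).
by apply: eq_bigr => j _; rewrite cell_prob.
Qed.

(** Solves e_(m+1) = err + 2 del + gamma e_m with initial value at least 2D, the diameter of
    [-D, D]. One del comes from rounding the reward in the integral, the other from [next_step]. *)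
Definition prefix_error m : R := (err + 2 * del) / (1 - gamma) + gamma ^+ m * (2 * D).

(** Induction on the number m of unfolded steps, over all histories and test functions at once since
    both change in a step. The weight by the probability of the history replaces conditioning on an
    event that may be null. *)
Lemma prefix_approx m n xs acts Bs L g :
  (forall t, measurable (Bs t)) -> Bs n = setT -> lip L g ->
  `|\int[P]_w (\1_(prefix n xs acts Bs) w * g (Z n w))
    - fine (P (prefix n xs acts Bs)) * qdist_int z (xs n) (acts n) g|
  <= fine (P (prefix n xs acts Bs)) * (L * prefix_error m).
Proof.
have /andP[g0 g1] := hgamma.
have bgZ n' L' g' c k : lip L' g' -> bounded_rv (fun w => g' (c + k * Z n' w)).
  move=> gL; apply: (bounded_rv_lip (D := `|c| + `|k| * D) gL).
    apply: measurable_funD => //; apply: measurable_funM => //.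
    exact: measurable_clamped_return.
  move=> w; rewrite (le_trans (ler_normD _ _))// lerD2l normrM ler_wpM2l//.
  exact: clamped_return_bound.
elim: m n xs acts Bs L g => [|m IH] n xs acts Bs L g mB BnT gL;
  have L0 := lip_ge0 gL; have mE := measurable_prefix n xs acts mB;
  have bE := bounded_rv_indic R mE.
  have bg : bounded_rv (fun w => g (Z n w)).
    by have := bgZ n _ _ 0 1 gL; under eq_fun do rewrite add0r mul1r.
  rewrite mulrC -RintegralT_indic// -RintegralT_Zl// RintegralT_indic// [leRHS]mulrC.
  apply: RintegralT_dist => //; [exact: bounded_rvM| |move=> w].
    by apply: bounded_rvM => //; exact: bounded_rv_cst.
  rewrite [_ * g _]mulrC -mulrBl normrM [X in _ * X]ger0_norm ?indicE ?ler0n// ler_wpM2r//.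
  have [u0 u1] := is_fdist_uniform R hK.
  rewrite /qdist_int -[g (Z n w)]mul1r -u1 mulr_suml -sumrB.
  rewrite -[leRHS]mul1r -u1 mulr_suml (le_trans (ler_norm_sum _ _ _))//.
  apply: ler_sum => i _; rewrite -mulrBr normrM ger0_norm// ler_wpM2l//.
  rewrite (le_trans (gL _ _))// ler_wpM2l// /prefix_error expr0 mul1r.
  have c0 : 0 <= (err + 2 * del) / (1 - gamma).
    by rewrite divr_ge0//; move: err0 d0; lra.
  have := clamped_return_bound n w; have := zD (xs n) (acts n) i.
  have := ler_normB (Z n w) (z (xs n) (acts n) i); lra.
pose E := next n xs acts Bs.
have mEt t : measurable (E t).
  by apply: measurable_prefix; exact: next_measurable_sets.
have bEt t := bounded_rv_indic R (mEt t).
have bg : bounded_rv (fun w => g (Z n w)).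
  by have := bgZ n _ _ 0 1 gL; under eq_fun do rewrite add0r mul1r.
pose gt (t : X * A * 'I_N) y := g (b t.2 + gamma * y).
have gtL t : lip (L * gamma) (gt t) by exact: lip_affine.
have i1 : \int[P]_w (\1_(prefix n xs acts Bs) w * g (Z n w)) =
    \sum_t \int[P]_w (\1_(E t) w * g (Z n w)).
  rewrite -RintegralT_sum => [|t]; last exact: bounded_rvM.
  by apply: eq_Rintegral => w _; rewrite -mulr_suml indic_next.
(* On each child the truncated reward is within del of the left node of its cell; what remains is an
   L gamma-Lipschitz function of the next tail return, covered by the induction hypothesis. *)
have i2 : `|\sum_t \int[P]_w (\1_(E t) w * g (Z n w)) -
    \sum_t fine (P (E t)) * qdist_int z t.1.1 t.1.2 (gt t)| <=
    fine (P (prefix n xs acts Bs)) * (L * del + L * gamma * prefix_error m).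
  rewrite -sumP// mulr_suml -sumrB (le_trans (ler_norm_sum _ _ _))//.
  apply: ler_sum => t _.
  have bgt : bounded_rv (fun w => \1_(E t) w * gt t (Z n.+1 w)).
    by apply: bounded_rvM => //; exact: bgZ gL.
  rewrite (le_trans (ler_distD (\int[P]_w (\1_(E t) w * gt t (Z n.+1 w))) _ _))//.
  rewrite mulrDr lerD//.
    rewrite mulrC; apply: RintegralT_dist => //; first exact: bounded_rvM.
    move=> w; rewrite -mulrBr normrM [X in X * _]ger0_norm !indicE ?ler0n//.
    have [wE|_] := boolP (w \in E t); last first.
      by rewrite mul0r mulr0.
    rewrite mul1r mulr1 (le_trans (gL _ _))// ler_wpM2l// clamped_returnS.
    move: wE; rewrite mem_next// => /and4P[_ _ _].
    rewrite inE => /andP[h1 h2].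
    have s : b t.2.+1 - b t.2 = del by exact: grid_step.
    have -> : clamp Rmax (Rs n w) + gamma * Z n.+1 w - (b t.2 + gamma * Z n.+1 w) =
      clamp Rmax (Rs n w) - b t.2 by ring.
    rewrite ger0_norm ?subr_ge0; last exact: ltW h1.
    by rewrite -s lerD2r; exact: h2.
  have := IH n.+1 (upd xs n.+1 t.1.1) (upd acts n.+1 t.1.2)
    (upd (upd Bs n (cell t.2)) n.+1 setT) _ _ (next_measurable_sets n t.2 mB) _ (gtL t).
  by rewrite /upd !eqxx; apply.
have i3 := next_step xs acts mB BnT gL.
have i4 := herr (xs n) (acts n) gL.
have P0 := prefix_prob_ge0 n xs acts Bs.
rewrite i1.
(* Two intermediate quantities: eta in place of the tail return on the children, then T eta at the
   parent. The last gap is the residual [i4]. *)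
rewrite (le_trans (ler_distD (\sum_t fine (P (E t)) * qdist_int z t.1.1 t.1.2 (gt t)) _ _))//.
apply: (le_trans (lerD i2 (ler_distD (fine (P (prefix n xs acts Bs)) *
  bellman_int gamma Rmax p pi Rdist z (xs n) (acts n) g) _ _))).
apply: (le_trans (lerD (lexx _) (lerD i3 (lexx _)))).
rewrite -mulrBr normrM (ger0_norm P0).
apply: (le_trans (lerD (lexx _) (lerD (lexx _) (ler_wpM2l P0 i4)))).
rewrite -!mulrDr -!mulrA -!mulrDr ler_wpM2l// ler_wpM2l//.
rewrite /prefix_error exprS le_eqVlt; apply/orP; left; apply/eqP; field.
by rewrite subr_eq0 gt_eqF.
Qed.

End one_step.

(** The event fixing the initial state and action has probability one. In [prefix_error] the terms
    in del and in gamma^m are then made arbitrarily small. *)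
Lemma return_approx L g : lip L g ->
  `|\int[P]_w g (Z 0 w) - qdist_int z x0 a0 g| <= L * (err / (1 - gamma)).
Proof.
move=> gL; have L0 := lip_ge0 gL; have /andP[g0 g1] := hgamma.
have mZ := measurable_clamped_return 0.
pose E := prefix 0 (fun=> x0) (fun=> a0) (fun=> setT).
have mT : forall t : nat, measurable (setT : set R) by [].
have mE : measurable E by exact: measurable_prefix.
have PE : fine (P E) = 1.
  by rewrite prefix_prob// !eqxx big_ord1 big_ord0 /rr probability_setT/= !mulr1.
have bg : bounded_rv (fun w => g (Z 0 w)) by exact: bounded_rv_lip gL mZ (clamped_return_bound 0).
have bE := bounded_rv_indic R mE.
have [_ [C gC]] := bg.
have -> : \int[P]_w g (Z 0 w) = \int[P]_w (\1_E w * g (Z 0 w)).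
  apply/eqP; rewrite -subr_eq0 -normr_le0.
  have -> : 0 = C * fine (P (~` E)).
    rewrite probability_setC//; have PEf : P E \is a fin_num by exact: fin_num_measure.
    by rewrite -(fineK PEf) PE -EFinB subrr mulr0.
  apply: RintegralT_dist => //; [exact: measurableC|exact: bounded_rvM|move=> w].
  rewrite !indicE in_setC; case: (w \in E); first by rewrite mul1r subrr normr0 mulr0.
  by rewrite mul0r subr0 mulr1.
apply/ler_addgt0Pr => e e0.
(* Makes 2 L del / (1 - gamma) at most e/2; the choice of m below does the same for the term in
   gamma^m. L + 1 and D + 1 guard against zero denominators. *)
pose del := (1 - gamma) * e / (4 * (L + 1)).
have d0 : 0 < del by rewrite divr_gt0 ?mulr_gt0//; lra.
have D0 : 0 <= D by rewrite divr_ge0 ?ltW//; lra.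
have [N [DN _]] := grid_cover Rmax d0.
have e1 : 0 < e / (4 * (L + 1) * (D + 1)) by rewrite divr_gt0 ?mulr_gt0//; lra.
have [m hm] : exists m, gamma ^+ m <= e / (4 * (L + 1) * (D + 1)).
  have gn : `|gamma| < 1 by rewrite ger0_norm.
  have [m _ hm] := (cvgrPdist_le (F := \oo) _ _).1 (cvg_geometric 1 gn) _ e1.
  exists m; have := hm m (leqnn m).
  by rewrite /= sub0r normrN mul1r ger0_norm ?exprn_ge0.
have := prefix_approx d0 DN m (n := 0%N) (fun=> x0) (fun=> a0) mT erefl gL.
rewrite -/E PE !mul1r => /le_trans; apply.
rewrite /prefix_error mulrDr mulrDl mulrDr -addrA lerD2l.
have h1 : L * (2 * del / (1 - gamma)) <= e / 2.
  have -> : L * (2 * del / (1 - gamma)) = L / (L + 1) * (e / 2).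
    by rewrite /del; field; apply/andP; split; lra.
  by rewrite ler_piMl ?ler_pdivrMr ?mul1r; lra.
have h2 : L * (gamma ^+ m * (2 * D)) <= e / 2.
  apply: (@le_trans _ _ (L * (e / (4 * (L + 1) * (D + 1)) * (2 * D)))).
    by rewrite ler_wpM2l// ler_wpM2r// mulr_ge0.
  have -> : L * (e / (4 * (L + 1) * (D + 1)) * (2 * D)) =
      L / (L + 1) * (D / (D + 1)) * (e / 2) by field; apply/andP; split; lra.
  rewrite ler_piMl; [by []|lra|].
  have frac (u : R) : 0 <= u -> 0 <= u / (u + 1) <= 1.
    by move=> u0; rewrite divr_ge0 ?ler_pdivrMr ?mul1r/=; lra.
  have /andP[? ?] := frac L L0; have /andP[? ?] := frac D D0.
  exact: mulr_ile1.
by lra.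
Qed.

End mdp_return.

Theorem theorem3 (R : realType) (gamma Rmax : R) (K : nat)
  (hgamma : 0 <= gamma < 1) (hRmax : 0 < Rmax) (hK : (1 <= K)%N)
  (X A : finType) (p : X -> A -> X -> R) (pi : X -> A -> R)
  (Rdist : X -> A -> probability R R)
  (hp : forall x a, is_fdist (p x a)) (hpi : forall x, is_fdist (pi x))
  (hR : forall x a, Rdist x a [set r | `|r| <= Rmax] = 1%E)
  (z : X -> A -> 'I_K -> R)
  (hfix : forall x a (B : set R), measurable B ->
     qdist z x a B = proj_W1 K (bellman p pi Rdist gamma (qdist z) x a) B) :
  forall (x : X) (a : A) (d : measure_display) (T : measurableType d)
    (P : probability T R) (Xs : nat -> T -> X) (As : nat -> T -> A) (Rs : nat -> T -> R),
  mdp_process p pi Rdist x a P Xs As Rs ->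
  K%:R^-1 * \sum_(i < K)
      `|quantile (return_law P gamma Rs) (tau_lvl R i)
        - quantile (qdist z x a) (tau_lvl R i)|
  <= 2 * Rmax * (5 - 2 * gamma) / ((1 - gamma) ^+ 2 * K%:R).
Proof.
move=> x a d T P Xs As Rs hproc; have /andP[g0 g1] := hgamma.
have K0 : 0 < K%:R :> R by rewrite ltr0n.
pose D := Rmax / (1 - gamma).
have D0 : 0 <= D by rewrite divr_ge0 ?(ltW hRmax)//; lra.
have zD := fixpoint_bound hgamma hRmax hK hp hpi hR hfix.
have herr := bellman_error hgamma hRmax hK hp hpi hR hfix.
have err0 : 0 <= D / K%:R by rewrite divr_ge0.
have approx := return_approx hgamma hRmax hK hp hpi zD err0 herr hproc.
have mZ := measurable_clamped_return gamma Rmax hproc 0.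
have ZD := clamped_return_bound hgamma hRmax Rs 0.
have Fc := is_cdf_rv P mZ ZD.
have FI := integrates_rv P mZ ZD.
set F := cdf_of _ _ in Fc FI.
have qE (i : 'I_K) : quantile (return_law P gamma Rs) (tau_lvl R i) =
    cdf_quantile F (tau_lvl R i).
  by apply: quantileE => y; exact: (return_law_ray gamma hR hproc).
(* Both families are quantiles at increasing levels, hence sorted as the potential requires, even if
   z is not. *)
have [f [fL hf]] := kantorovich_potential (quantile_proj_mono hK Fc)
  (quantile_fixpoint_mono hgamma hRmax hK hp hpi hR hfix x a).
have h1 := quantile_proj_error hK Fc FI fL.
have h2 := approx _ _ fL.
have -> : K%:R^-1 * \sum_(i < K) `|quantile (return_law P gamma Rs) (tau_lvl R i)
        - quantile (qdist z x a) (tau_lvl R i)| =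
    \sum_(i < K) uniform_fdist R i * f (cdf_quantile F (tau_lvl R i)) - qdist_int z x a f.
  under eq_bigr => i _ do rewrite qE -hf.
  rewrite sumrB (quantile_fixpoint_sum hgamma hRmax hK hp hpi hR hfix).
  by rewrite mulrBr !mulr_sumr.
(* The two terms compare the return law with its own midpoint quantiles, and the return law with
   eta. *)
apply: (@le_trans _ _ (D / K%:R + D / K%:R / (1 - gamma))).
  move: h1 h2 => /=; rewrite -/D !mul1r => h1 h2.
  rewrite (le_trans (ler_norm _))// (le_trans (ler_distD (\int[P]_w f (clamped_return gamma Rmax Rs 0 w)) _ _))//.
  by rewrite lerD// distrC.
have -> : D / K%:R + D / K%:R / (1 - gamma) =
    Rmax * (2 - gamma) / ((1 - gamma) ^+ 2 * K%:R).
  rewrite /D; field; rewrite gt_eqF//= subr_eq0 gt_eqF//.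
rewrite ler_wpM2r//; first by rewrite invr_ge0 mulr_ge0// sqr_ge0.
(* It remains that 2 - gamma <= 10 - 4 gamma, which holds since gamma < 1. *)
have -> : 2 * Rmax * (5 - 2 * gamma) = Rmax * (10 - 4 * gamma) by ring.
by rewrite ler_pM2l//; lra.
Qed.
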